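(* Let $GL(n)$ denote $GL(n,\mathbb R)$ or $GL(n,\mathbb C)$, and let $\Omega$ be the $2$-form on $GL_*\subset GL(n)$ defined in the context. On a dense open algebraic subset of $GL_*$ the $2$-form $\Omega$ has a representation $$\Omega=\sum_{\nu=1}^N dp_\nu\wedge dq_\nu,\qquad N=\tfrac12(n^2-n),$$ where $p_\nu$ and $q_\nu$ are analytic (holomorphic in the complex case) and the $1$-forms $dp_\nu,dq_\nu$ are independent. In particular, $\Omega$ is closed and generically has rank $n^2-n$.
   Context: $GL^{\pm}=\{a\in GL(n):a_{jk}=0\text{ if }\pm(j-k)>0\}$; $GL^\pm_0=\{a\in GL^\pm:\operatorname{diag}(a)=1\}$; $GL_*=(GL^+\cdot GL^-)\cap(GL^-\cdot GL^+)$. Each $a\in GL_*$ has unique factorizations $a=a_+v_+^{-1}=a_-v_-^{-1}$ with $a_\pm\in GL^\pm$, $v_\pm\in GL_0^\mp$. Regarding $a_\pm,v_\pm$ as functions of $a$, $da_\pm,dv_\pm$ are matrices of $1$-forms and $$\Omega=\operatorname{tr}[v_+^{-1}dv_+\wedge a_+^{-1}da_+-v_-^{-1}dv_-\wedge a_-^{-1}da_-].$$ In the complex case the functions and forms are complex-valued.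
   Formalization: In the complex case p_ν and q_ν are only local holomorphic branches (multivalued on the dense open algebraic set) whose differentials dp_ν, dq_ν are single-valued there; single-valued p_ν, q_ν fail for n=2, since Ω has a nonzero period on a torus. *)

(* Defs.v *)
From HB Require Import structures.
From mathcomp Require Import all_boot all_order all_algebra.
From mathcomp Require Import all_classical all_reals all_analysis.
From mathcomp Require Export complex.
From mathcomp Require Import -(notations) mpoly.

Set Implicit Arguments.
Unset Strict Implicit.
Unset Printing Implicit Defensive.

Import Order.TTheory GRing.Theory Num.Theory.
Import numFieldNormedType.Exports.

Local Open Scope classical_set_scope.
Local Open Scope ring_scope.

(* Everything is set up over a numFieldType K, to be used with K = R or        *)
(* K = R[i]; differentials, power series and polynomials are then K-linear,    *)
(* resp. with coefficients in K, so that K = R[i] gives the holomorphic theory. *)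
Section Forms.
Variables (K : numFieldType) (n : nat).
Local Notation M := 'M[K]_n.

Definition GLplus : set M :=
  [set a | a \in unitmx /\ forall j k : 'I_n, (k < j)%N -> a j k = 0].
Definition GLminus : set M :=
  [set a | a \in unitmx /\ forall j k : 'I_n, (j < k)%N -> a j k = 0].
Definition GLplus0 : set M := [set a | GLplus a /\ forall j, a j j = 1].
Definition GLminus0 : set M := [set a | GLminus a /\ forall j, a j j = 1].

Definition GLstar : set M :=
  [set a | (exists b c, [/\ GLplus b, GLminus c & a = b *m c]) /\
           (exists b c, [/\ GLminus b, GLplus c & a = b *m c])].

(* On GLstar the pair (a_+, v_+), resp. (a_-, v_-), is the unique element of   *)
(* the set below; off GLstar its value is irrelevant.                          *)
Definition factor_plus (a : M) : M * M :=
  xget (0, 0) [set x | [/\ GLplus x.1, GLminus0 x.2 & a = x.1 *m invmx x.2]].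
Definition factor_minus (a : M) : M * M :=
  xget (0, 0) [set x | [/\ GLminus x.1, GLplus0 x.2 & a = x.1 *m invmx x.2]].

Definition aplus (a : M) : M := (factor_plus a).1.
Definition vplus (a : M) : M := (factor_plus a).2.
Definition aminus (a : M) : M := (factor_minus a).1.
Definition vminus (a : M) : M := (factor_minus a).2.

(* the matrix of 1-forms g^-1 dg, at a, on the tangent vector u *)
Definition logd (g : M -> M) (a u : M) : M := invmx (g a) *m 'd g a u.

(* wedge products are normalized by (x /\ y)(u, w) = x(u) y(w) - x(w) y(u) *)
Definition wedge (x y : M -> K) (u w : M) : K := x u * y w - x w * y u.
Definition trwedge (x y : M -> M) (u w : M) : K :=
  \tr (x u *m y w - x w *m y u).

Definition Omega (a u w : M) : K :=
  trwedge (logd vplus a) (logd aplus a) u w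
  - trwedge (logd vminus a) (logd aminus a) u w.

Definition two_form_mx (B : M -> M -> K) : 'M[K]_(n * n) :=
  \matrix_(i, j) B (vec_mx (delta_mx 0 i)) (vec_mx (delta_mx 0 j)).

(* d of a 2-form, evaluated on constant vector fields *)
Definition closed_on (D : set M) (w : M -> M -> M -> K) : Prop :=
  forall a, D a ->
    (forall u v, differentiable (fun x => w x u v : K^o) a) /\
    (forall u v t,
       'd (fun x => w x v t : K^o) a u - 'd (fun x => w x u t : K^o) a v
       + 'd (fun x => w x u v : K^o) a t = 0).

Definition mx_coord (a : M) : 'I_(n * n) -> K := fun i => mxvec a 0 i.

(* dense Zariski open subsets of GLstar *)
Definition dense_open_algebraic (U : set M) : Prop :=
  [/\ exists s : seq (mpoly.mpoly (n * n) K),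
        U = GLstar `&` [set a | exists2 P, P \in s &
                                  mpoly.meval (mx_coord a) P != 0],
      open U & GLstar `<=` closure U].

Definition monom (m : mpoly.multinom (n * n)) (h : M) : K :=
  \prod_i mx_coord h i ^+ mpoly.fun_of_multinom m i.

(* f is, on a polydisc around a, the sum of an absolutely convergent power     *)
(* series in the n^2 matrix entries; bmultinom _ d is the type of the          *)
(* multi-indices of total degree < d.                                          *)
Definition analytic_at (f : M -> K) (a : M) : Prop :=
  exists (c : mpoly.multinom (n * n) -> K) (r : K), 0 < r /\
    forall h : M, (forall i j, `|h i j| < r) ->
      (exists B : K, forall d,
         \sum_(m : mpoly.bmultinom (n * n) d) `|c m * monom m h| <= B) /\
      (fun d => \sum_(m : mpoly.bmultinom (n * n) d) c m * monom m h : K^o)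
        @ \oo --> (f (a + h) : K^o).

Definition potential_on (V : set M) (x : M -> M -> K) (f : M -> K) : Prop :=
  forall a, V a -> analytic_at f a /\ x a =1 'd (f : M -> K^o) a.

Definition independent (I : finType) (x y : I -> M -> K) : Prop :=
  forall s t : I -> K,
    (forall u, \sum_i (s i * x i u + t i * y i u) = 0) ->
    forall i, s i = 0 /\ t i = 0.

Definition canonical_on (I : finType) (U : set M) (x y : I -> M -> M -> K) :
    Prop :=
  forall a, U a ->
    (forall u w, Omega a u w = \sum_i wedge (x i a) (y i a) u w) /\
    independent (fun i => x i a) (fun i => y i a).

End Forms.

Arguments GLstar {K n}.
Arguments Omega {K n}.
Arguments dense_open_algebraic {K n} U.

(* Single-valued p_i, q_i on all of U. *)
Definition has_coordinates (K : numFieldType) (n : nat) (I : finType)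
    (U : set 'M[K]_n) : Prop :=
  exists p q : I -> 'M[K]_n -> K,
    (forall i a, U a -> analytic_at (p i) a /\ analytic_at (q i) a) /\
    canonical_on U (fun i a => 'd (p i : _ -> K^o) a)
                   (fun i a => 'd (q i : _ -> K^o) a).

(* The p_i, q_i are logarithms: over the complex numbers they are multivalued  *)
(* on U, with single-valued differentials x_i = dp_i and y_i = dq_i. They      *)
(* cannot be single-valued on a Zariski open U: for n = 2,                     *)
(*   Omega = d log (det a / (a11 a22)) /\ d log (a12 / a21)                    *)
(* has a nonzero period on some 2-torus inside any such U.                     *)
Definition has_multivalued_coordinates (K : numFieldType) (n : nat)
    (I : finType) (U : set 'M[K]_n) : Prop :=
  exists x y : I -> 'M[K]_n -> 'M[K]_n -> K,
    (forall a, U a -> exists V : set 'M[K]_n, [/\ open V, V a &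
       exists p q : I -> 'M[K]_n -> K, forall i,
         potential_on V (x i) (p i) /\ potential_on V (y i) (q i)]) /\
    canonical_on U x y.

(* Main.v *)
From HB Require Import structures.
Require Import Defs.
From mathcomp Require Import all_boot all_order all_algebra.
From mathcomp Require Import all_classical all_reals all_analysis.
From mathcomp Require Import perm ring zify.
From mathcomp Require Import -(notations) mpoly.

Set Implicit Arguments.
Unset Strict Implicit.
Unset Printing Implicit Defensive.

Import Order.TTheory GRing.Theory Num.Theory.
Import numFieldNormedType.Exports.

Local Open Scope classical_set_scope.
Local Open Scope ring_scope.

(** Fix a strict total order [lt] on the indices and factor [a = b v^-1] with
    [b] upper triangular and [v] unit lower triangular for [lt].  For a tangent
    vector [u] put [P u = b^-1 u v].  Differentiating [a v = b] gives
    [b^-1 db - v^-1 dv = P], so [b^-1 db] is the upper part of [P] and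
    [- v^-1 dv] its strictly lower part.  Hence [Omega] is the difference, for
    the usual order and its opposite, of the 2-forms
    [phi = tr (v^-1 dv /\ b^-1 db)], which are quadratic in [P] ([OmegaE]).

    Closedness.  Since [dP] is itself quadratic in [P], [d phi] is a cubic trace
    in [P]; it comes out as [tr (P t P v P u) - tr (P t P u P v)], and [P u] is
    conjugate to [a^-1 u].  So [d phi] does not depend on the order and cancels
    in [d Omega] ([dtrace_cyclic], [factor_form_cyclic], [closed_Omega]).

    Canonical form.  Let [N] be the inverse of the block of [a] with indices in
    [I], padded by zeros, let [S = a - a N a] be the Schur complement, and let
    [peel I s] be the 2-form
    [(F u w - F w u) s s / S s s], where [F u w = (1 - a N) u N w (1 - N a)].
    The triangular factors are explicit in terms of these matrices, and
    [phi] is the sum over [s] of [peel (lt s) s] ([factor_trace]).  When an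
    index is added to [I], all these matrices change by explicit rational
    corrections, and for two indices [i], [j] outside [M] the mixed difference of
    [peel] depends only on the 2 by 2 block [[x, y], [z, t]] of the Schur
    complement of [M] on rows and columns [i], [j], and on its differential:
    [peel (M + j) i - peel M i - peel (M + i) j + peel M j
       = dlog ((x t - y z) / (x t)) /\ dlog (y / z)] ([second_difference]).
    Taking for [M] the open interval between [i] and [j] and summing over
    [i < j], the left hand sides telescope to the difference of the two forms
    [phi] ([peel_telescope]).  So [p] and [q] are logarithms of rational
    functions of the entries of [a], one pair for each [i < j].

    The dense open set is where the minors occurring in these quotients do not
    vanish; none of them is identically zero, and a nonzero polynomial has
    nonroots in every ball ([pev_dense]).  On the elementary matrix [E_rs] the
    forms of the pair [i < j] vanish unless [r] and [s] both lie between [i] and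
    [j], so evaluation on [E_ij] and [E_ji], the widest gap first, shows that
    the forms are independent ([forms_independent]); this gives the rank
    ([rank_canonical]).

    Analyticity.  Near [a], write a polynomial as [P (a + h) = P a (1 + R h)],
    where [R] is a polynomial without constant term.  The series of the
    logarithm in powers of [R h] may be rearranged by monomials of [h], because
    the norm [sum |R_m| rho^|m|] is submultiplicative and small for small [rho]
    ([analytic_log]).  The logarithm is [ln |x|] over the reals, and over the
    complex numbers the principal branch of [log (z / z0)] on the half plane
    [0 < Re (z / z0)], which makes [p] and [q] local there while their
    differentials are global. *)

(** * Padded inverses of principal blocks *)
HB.lock Definition proj (F : fieldType) n (I : pred 'I_n) : 'M[F]_n :=
  diag_mx (\row_k (I k)%:R).

Definition pad (F : fieldType) n (I : pred 'I_n) (a : 'M[F]_n) : 'M[F]_n :=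
  proj F I *m a *m proj F I + (1%:M - proj F I).

(** Full-size matrices are used throughout instead of submatrices: the block of
    [a] on [I] is completed by the identity before inversion, so that all
    products stay in the same ring. *)
HB.lock Definition padinv (F : fieldType) n (I : pred 'I_n) (a : 'M[F]_n) : 'M[F]_n :=
  proj F I *m invmx (pad I a) *m proj F I.

(** Left and right block elimination on the rows, resp. columns, in [I]: both
    [elim_l I a *m a] and [a *m elim_r I a] are the Schur complement. *)
HB.lock Definition elim_l (F : fieldType) n (I : pred 'I_n) (a : 'M[F]_n) : 'M[F]_n :=
  1%:M - a *m padinv I a.
HB.lock Definition elim_r (F : fieldType) n (I : pred 'I_n) (a : 'M[F]_n) : 'M[F]_n :=
  1%:M - padinv I a *m a.
HB.lock Definition schur (F : fieldType) n (I : pred 'I_n) (a : 'M[F]_n) : 'M[F]_n :=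
  a - a *m padinv I a *m a.

(** The differential of [schur I] at [a], as [mx_diff_schur] shows. *)
HB.lock Definition dschur (F : fieldType) n (I : pred 'I_n) (a u : 'M[F]_n) : 'M[F]_n :=
  elim_l I a *m u *m elim_r I a.

(** The second order term of [schur I] at [a], up to sign: its antisymmetrized
    diagonal entries are the building blocks of the 2-forms. *)
HB.lock Definition quad (F : fieldType) n (I : pred 'I_n) (a u w : 'M[F]_n) : 'M[F]_n :=
  elim_l I a *m u *m padinv I a *m w *m elim_r I a.

Section PaddedInverse.
Variables (F : fieldType) (n : nat).
Implicit Types (I J : pred 'I_n) (a u w X Y Z : 'M[F]_n) (i j k l s : 'I_n).

Local Notation proj := (proj F).

Lemma proj_mulE m I (X : 'M[F]_(n, m)) k (l : 'I_m) : (proj I *m X) k l = (I k)%:R * X k l.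
Proof. by rewrite proj.unlock mul_diag_mx !mxE. Qed.

Lemma mul_projE m I (X : 'M[F]_(m, n)) (k : 'I_m) l : (X *m proj I) k l = X k l * (I l)%:R.
Proof. by rewrite proj.unlock mul_mx_diag !mxE. Qed.

Lemma projK I : proj I *m proj I = proj I.
Proof.
by apply/matrixP=> k l; rewrite proj_mulE proj.unlock !mxE; case: (I k); case: (k == l) => /=;
  rewrite ?mul0r ?mul1r ?mulr0n.
Qed.

Lemma tr_proj I : (proj I)^T = proj I.
Proof. by rewrite proj.unlock tr_diag_mx. Qed.

Definition is_padinv I a X :=
  [/\ proj I *m X = X, X *m proj I = X,
      proj I *m a *m X = proj I & X *m a *m proj I = proj I].

Lemma padinvP I a : pad I a \in unitmx -> is_padinv I a (padinv I a).
Proof.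
set e := proj I; set G := pad I a => uG.
have ee : e *m e = e := projK I.
have eG : e *m G = e *m a *m e.
  by rewrite /G /pad -/e mulmxDr !mulmxA ee mulmxBr mulmx1 ee subrr addr0.
have Ge : G *m e = e *m a *m e.
  by rewrite /G /pad -/e mulmxDl -!mulmxA ee mulmxBl mul1mx ee subrr addr0.
have eGi : e *m invmx G = invmx G *m e.
  by rewrite -[LHS]mul1mx -(mulVmx uG) -!mulmxA (mulmxA G) Ge -eG -[e *m G *m _]mulmxA
    mulmxV // mulmx1.
rewrite /is_padinv padinv.unlock -/e -/G; split.
- by rewrite !mulmxA ee.
- by rewrite -!mulmxA ee.
- by rewrite !mulmxA -eG -(mulmxA e G) mulmxV // mulmx1 ee.
- by rewrite eGi -[invmx G *m e *m e]mulmxA ee -!mulmxA (mulmxA e) -Ge mulKmx.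
Qed.

Lemma padinv_uniq I a X : is_padinv I a X -> pad I a \in unitmx /\ padinv I a = X.
Proof.
case=> eX Xe eaX Xae; set e := proj I in eX Xe eaX Xae.
have ee : e *m e = e := projK I.
have uG : pad I a \in unitmx.
  suff /mulmx1_unit[] : (X + (1%:M - e)) *m pad I a = 1%:M by [].
  have Qe : (1%:M - e) *m e = 0 by rewrite mulmxBl mul1mx ee subrr.
  have XQ : X *m (1%:M - e) = 0 by rewrite mulmxBr mulmx1 Xe subrr.
  rewrite /pad -/e mulmxDl [X *m _]mulmxDr [(1%:M - e) *m (_ + _)]mulmxDr XQ.
  rewrite !mulmxA Xe Xae Qe !mul0mx addr0 add0r.
  by rewrite mulmxBr mulmx1 Qe subr0 addrC subrK.
split=> //; case: (padinvP uG); rewrite -/e => eN Ne eaN Nae.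
transitivity (X *m a *m padinv I a).
  by rewrite -{1}eN -Xae -mulmxA eN.
by rewrite -{1}Xe -!mulmxA (mulmxA e) eaN.
Qed.

Lemma elim_lE I a : elim_l I a = 1%:M - a *m padinv I a. Proof. by rewrite elim_l.unlock. Qed.
Lemma elim_rE I a : elim_r I a = 1%:M - padinv I a *m a. Proof. by rewrite elim_r.unlock. Qed.
Lemma schurE I a : schur I a = a - a *m padinv I a *m a.
Proof. by rewrite schur.unlock. Qed.
Lemma dschurE I a u : dschur I a u = elim_l I a *m u *m elim_r I a.
Proof. by rewrite dschur.unlock. Qed.
Lemma quadE I a u w :
  quad I a u w = elim_l I a *m u *m padinv I a *m w *m elim_r I a.
Proof. by rewrite quad.unlock. Qed.

Lemma elim_l_mul I a : elim_l I a *m a = schur I a.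
Proof. by rewrite elim_l.unlock schur.unlock mulmxBl mul1mx. Qed.
Lemma mul_elim_r I a : a *m elim_r I a = schur I a.
Proof. by rewrite elim_r.unlock schur.unlock mulmxBr mulmx1 mulmxA. Qed.

Lemma mxDE X Y k l : (X + Y) k l = X k l + Y k l. Proof. by rewrite mxE. Qed.
Lemma mxBE X Y k l : (X - Y) k l = X k l - Y k l. Proof. by rewrite !mxE. Qed.
Lemma mxNE X k l : (- X) k l = - X k l. Proof. by rewrite mxE. Qed.
Lemma mxZE (c : F) X k l : (c *: X) k l = c * X k l. Proof. by rewrite mxE. Qed.

Lemma mul_delta_mulE (X Y : 'M[F]_n) j k l :
  (X *m delta_mx j j *m Y) k l = X k j * Y j l.
Proof.
rewrite mxE (bigD1 j) //= big1 ?addr0; last first.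
  move=> i ij; rewrite mxE big1 ?mul0r // => m _; rewrite mxE (negPf ij) andbF mulr0 //.
rewrite mxE (bigD1 j) //= big1 ?addr0 ?mxE ?eqxx ?mulr1 // => i ij.
by rewrite mxE (negPf ij) mulr0.
Qed.

Section Border.
Variables (I I' : pred 'I_n) (s : 'I_n) (a : 'M[F]_n).
Hypotheses (Is : ~~ I s) (I'E : forall k, I' k = (k == s) || I k).
Hypothesis uG : pad I a \in unitmx.
Hypothesis t0 : schur I a s s != 0.

Let t := schur I a s s.
Let d := delta_mx s s : 'M[F]_n.

Let projI' : proj I' = proj I + d.
Proof.
rewrite proj.unlock; apply/matrixP=> k l; rewrite !mxE I'E.
have [->|ks] /= := eqVneq k s; last by rewrite addr0.
by rewrite (negPf Is) mul0rn add0r eq_sym; case: (l == s).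
Qed.

Let dd : d *m d = d. Proof. by rewrite mul_delta_mx. Qed.
Let ed : proj I *m d = 0.
Proof.
apply/matrixP=> k l; rewrite proj_mulE !mxE.
by have [->|] /= := eqVneq k s; rewrite ?(negPf Is) ?mul0r ?mulr0.
Qed.
Let de : d *m proj I = 0.
Proof. by rewrite -[LHS]trmxK trmx_mul tr_proj trmx_delta ed trmx0. Qed.

Let dXd X : d *m X *m d = X s s *: d.
Proof.
apply/matrixP=> k l; rewrite !mxE (bigD1 s) //= big1 ?addr0.
  rewrite mxE (bigD1 s) //= big1 ?addr0 ?mxE ?eqxx ?andbT ?mul1r.
    by case: (k == s); case: (l == s); rewrite /= ?mulr0 ?mulr1 ?mul0r ?mul1r.
  by move=> i is'; rewrite mxE (negPf is') andbF mul0r.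
by move=> i is'; rewrite [d _ _]mxE (negPf is') mulr0.
Qed.

(** The bordering formula.  Adding the index [s] to [I] changes the padded
    inverse by a matrix of rank one, with the pivot [t] as denominator. *)
Lemma padinv_border_spec :
  is_padinv I' a (padinv I a + t^-1 *: (elim_r I a *m d *m elim_l I a)).
Proof.
have [eN Ne eaN Nae] := padinvP uG.
set e := proj I in eN Ne eaN Nae *; set N := padinv I a in eN Ne eaN Nae *.
set C := elim_l I a; set C' := elim_r I a.
have e'N : (e + d) *m N = N.
  by rewrite mulmxDl eN -{2}eN mulmxA de mul0mx addr0.
have Ne' : N *m (e + d) = N.
  by rewrite mulmxDr Ne -{2}Ne -mulmxA ed mulmx0 addr0.
have eC'd : e *m C' = e - N *m a by rewrite /C' elim_r.unlock mulmxBr mulmx1 mulmxA eN.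
have Ced : C *m e = e - a *m N by rewrite /C elim_l.unlock mulmxBl mul1mx -mulmxA Ne.
have dN : d *m N = 0 by rewrite -eN mulmxA de mul0mx.
have Nd : N *m d = 0 by rewrite -Ne -mulmxA ed mulmx0.
have e'C'd : (e + d) *m C' *m d = C' *m d.
  rewrite mulmxDl eC'd /C' elim_r.unlock [d *m _]mulmxBr mulmx1 mulmxA dN mul0mx subr0.
  by rewrite mulmxDl !mulmxBl ed mul1mx dd sub0r addrC.
have dCe' : d *m C *m (e + d) = d *m C.
  rewrite -mulmxA mulmxDr Ced /C elim_l.unlock [_ *m d]mulmxBl mul1mx -mulmxA Nd mulmx0.
  by rewrite subr0 mulmxDr !mulmxBr de mulmx1 dd sub0r addrC.
have eS : e *m schur I a = 0.
  by rewrite schur.unlock -/N mulmxBr !mulmxA eaN subrr.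
have Se : schur I a *m e = 0.
  by rewrite schur.unlock -/N mulmxBl -!mulmxA (mulmxA N) Nae subrr.
rewrite /is_padinv projI' -/e; split.
- by rewrite mulmxDr e'N -scalemxAr !mulmxA e'C'd.
- by rewrite mulmxDl Ne' -scalemxAl -mulmxA -mulmxA (mulmxA d) dCe' -mulmxA.
- rewrite mulmxDr -scalemxAr !mulmxA -(mulmxA _ a C') mul_elim_r !mulmxDl eaN eS.
  rewrite !mul0mx add0r dXd -scalemxAl scalerA mulVf // scale1r.
  by rewrite /C elim_l.unlock -/N mulmxBr mulmx1 mulmxA -addrA [d *m a *m N + _]addrC subrK.
- rewrite mulmxDl -scalemxAl -[_ *m C *m a]mulmxA elim_l_mul mulmxDl -scalemxAl.
  rewrite mulmxDr Nae mulmxDr -[_ *m schur I a *m e]mulmxA Se mulmx0 add0r.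
  rewrite -[C' *m d *m _]mulmxA -[_ *m (d *m _) *m d]mulmxA dXd -scalemxAr.
  rewrite scalerA mulVf // scale1r /C' elim_r.unlock -/N mulmxBl mul1mx.
  by rewrite -addrA [N *m a *m d + _]addrC subrK.
Qed.
End Border.
End PaddedInverse.

(** * Bordering and the second difference *)
Section SecondDifference.
Variables (F : fieldType) (n : nat).
Implicit Types (I J : pred 'I_n) (a u w X Y Z : 'M[F]_n) (i j k l s : 'I_n).

Section BorderEntries.
Variables (I I' : pred 'I_n) (s : 'I_n) (a : 'M[F]_n).
Hypotheses (Is : ~~ I s) (I'E : forall k, I' k = (k == s) || I k).
Hypothesis uG : pad I a \in unitmx.
Hypothesis t0 : schur I a s s != 0.
Let t := schur I a s s.
Let d := delta_mx s s : 'M[F]_n.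

Lemma padinv_border : padinv I' a = padinv I a + t^-1 *: (elim_r I a *m d *m elim_l I a).
Proof. by case: (padinv_uniq (padinv_border_spec Is I'E uG t0)). Qed.

Lemma elim_l_border : elim_l I' a = elim_l I a - t^-1 *: (schur I a *m d *m elim_l I a).
Proof.
rewrite [LHS]elim_lE padinv_border mulmxDr -scalemxAr !mulmxA mul_elim_r opprD addrA.
by rewrite -[_ - a *m _]elim_lE.
Qed.

Lemma elim_r_border : elim_r I' a = elim_r I a - t^-1 *: (elim_r I a *m d *m schur I a).
Proof.
rewrite [LHS]elim_rE padinv_border mulmxDl -scalemxAl -[_ *m elim_l I a *m a]mulmxA.
by rewrite elim_l_mul opprD addrA -[_ - _ *m a]elim_rE.
Qed.

Lemma schur_border k l : schur I' a k l =
  schur I a k l - t^-1 * (schur I a k s * schur I a s l).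
Proof.
rewrite -mul_elim_r elim_r_border mulmxBr -scalemxAr !mulmxA mul_elim_r mxBE mxZE.
by rewrite mul_delta_mulE.
Qed.

(** Replacing [padinv I a] by its bordered value inside [quad] turns it into
    [Z]; the outer factors [elim_l], [elim_r] contribute the remaining terms.
    All are expressed by entries of the old matrices, which reduces
    [second_difference] to an identity between fractions. *)
Lemma quad_border u w k l :
  let S := schur I a in
  let Z k l := quad I a u w k l + t^-1 * (dschur I a u k s * dschur I a w s l) in
  quad I' a u w k l = Z k l - t^-1 * (Z k s * S s l) - t^-1 * (S k s * Z s l)
                      + t^-1 ^+ 2 * (S k s * Z s s * S s l).
Proof.
move=> S Z.
pose Zm := elim_l I a *m (u *m padinv I' a *m w) *m elim_r I a.
have ZE k' l' : Zm k' l' = Z k' l'.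
  have -> : Zm = quad I a u w + t^-1 *: (dschur I a u *m d *m dschur I a w).
    rewrite /Zm padinv_border !quadE !dschurE.
    rewrite [u *m _]mulmxDr [_ *m w]mulmxDl [elim_l I a *m _]mulmxDr [_ *m elim_r I a]mulmxDl.
    by rewrite -scalemxAr -scalemxAl -scalemxAr -scalemxAl !mulmxA.
  by rewrite mxDE mxZE mul_delta_mulE.
have -> : quad I' a u w = Zm - t^-1 *: (Zm *m d *m S) - t^-1 *: (S *m d *m Zm)
            + t^-1 ^+ 2 *: (S *m d *m Zm *m d *m S).
  rewrite quadE -[_ *m padinv I' a]mulmxA -[_ *m (_ *m padinv I' a) *m w]mulmxA.
  rewrite /Zm -/S elim_l_border elim_r_border -/S; move: (u *m _ *m w) => V.
  rewrite mulmxBl mulmxBl !mulmxBr -!scalemxAl -!scalemxAr !mulmxA.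
  by rewrite scalerA -expr2 opprB addrA addrAC.
by rewrite mxDE !mxBE !mxZE !mul_delta_mulE !ZE mulrA.
Qed.
End BorderEntries.

(** The contribution of the index [s] to the 2-form of a triangular
    factorization in which [I] is the set of indices beyond [s]. *)
Definition peel I s a u w : F :=
  (quad I a u w s s - quad I a w u s s) / schur I a s s.

(** With [[x, y], [z, t]] the block of [schur I a] at [i], [j], these are
    [dlog ((x t - y z) / (x t))] and [dlog (y / z)]. *)
Definition p_form I i j a u : F :=
  let S := schur I a in let D := dschur I a u in
  (D i i * S j j + S i i * D j j - D i j * S j i - S i j * D j i)
    / (S i i * S j j - S i j * S j i) - D i i / S i i - D j j / S j j.

Definition q_form I i j a u : F :=
  dschur I a u i j / schur I a i j - dschur I a u j i / schur I a j i.

(** The bordering formulas express both sides by the 2 by 2 blocks at [i], [j]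
    of [schur], [dschur u], [dschur w], [quad u w] and [quad w u].  The entries
    of [quad] cancel, and what is left is an identity of rational functions. *)
Lemma second_difference I Ii Ij i j a u w : i != j -> ~~ I i -> ~~ I j ->
    (forall k, Ii k = (k == i) || I k) -> (forall k, Ij k = (k == j) || I k) ->
    pad I a \in unitmx ->
    schur I a i i != 0 -> schur I a j j != 0 ->
    schur I a i j != 0 -> schur I a j i != 0 ->
    schur I a i i * schur I a j j - schur I a i j * schur I a j i != 0 ->
  peel Ij i a u w - peel I i a u w - (peel Ii j a u w - peel I j a u w)
  = p_form I i j a u * q_form I i j a w - p_form I i j a w * q_form I i j a u.
Proof.
move=> ij Hi Hj HIi HIj uG x0 t0 y0 z0 D0.
rewrite /peel (schur_border Hj HIj uG t0) (schur_border Hi HIi uG x0).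
rewrite !(quad_border Hj HIj uG t0) !(quad_border Hi HIi uG x0) /p_form /q_form /=.
move: (schur I a) x0 t0 y0 z0 D0 (quad I a u w) (quad I a w u)
  (dschur I a u) (dschur I a w) => S x0 t0 y0 z0 D0 Q1 Q2 D1 D2.
move: x0 t0 y0 z0 D0.
move: (S i i) (S j j) (S i j) (S j i) => x t y z x0 t0 y0 z0 D0.
by field; rewrite x0 t0 y0 z0 D0.
Qed.
End SecondDifference.

(** * Triangular matrices for a total order *)
Section Triangular.
Variables (F : fieldType) (n : nat) (lt : rel 'I_n).
Hypotheses (ltxx : irreflexive lt) (lt_tr : transitive lt).
Hypothesis lt_total : forall i j, i != j -> lt i j || lt j i.
Implicit Types (a b u v w X Y Z : 'M[F]_n) (i j k l s : 'I_n).
Local Notation proj := (proj F).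

Definition upper b := forall j k, lt k j -> b j k = 0.
Definition lower b := forall j k, lt j k -> b j k = 0.

Lemma rel_asym i j : lt i j -> lt j i = false.
Proof. by move=> ij; apply/negP=> /(lt_tr ij); rewrite ltxx. Qed.

Lemma lt_nlt i j k : lt i j -> ~~ lt i k -> lt k j.
Proof.
move=> ij; have [->|kj] := eqVneq k j; first by rewrite ij.
by case/orP: (lt_total kj) => // jk; rewrite (lt_tr ij jk).
Qed.

Lemma upper_proj b k : upper b -> proj (lt k) *m b = proj (lt k) *m b *m proj (lt k).
Proof.
move=> tb; apply/matrixP=> j l; rewrite mul_projE proj_mulE.
have [kj|_] := boolP (lt k j); last by rewrite !mul0r.
have [_|kl] := boolP (lt k l); first by rewrite mulr1.
by rewrite tb ?mulr0 ?mul0r // (lt_nlt kj kl).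
Qed.

(** Triangularity as stability of a flag of coordinate subspaces: in this form
    it passes to inverses. *)
Lemma proj_upper b :
  (forall k, proj (lt k) *m b = proj (lt k) *m b *m proj (lt k)) -> upper b.
Proof.
move=> H j k kj; have /matrixP/(_ j k) := H k.
by rewrite mul_projE proj_mulE kj ltxx mul1r mulr0.
Qed.

(** An injective linear map of a finite dimensional space sends a stable
    subspace onto itself, hence its inverse stabilizes that subspace too. *)
Lemma proj_inv (e b : 'M[F]_n) : b \in unitmx -> e *m e = e -> e *m b = e *m b *m e ->
  e *m invmx b = e *m invmx b *m e.
Proof.
move=> ub ee eb.
have sub : (e *m b <= e)%MS by rewrite eb submxMl.
have : (e <= e *m b)%MS.
  by rewrite -(geq_leqif (mxrank_leqif_sup sub)) mxrankMfree // row_free_unit.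
case/submxP=> X eX.
have -> : e *m invmx b = X *m e by rewrite {1}eX -!mulmxA mulmxV // mulmx1.
by rewrite -mulmxA ee.
Qed.

Lemma upper_inv b : b \in unitmx -> upper b -> upper (invmx b).
Proof.
move=> ub tb; apply: proj_upper => k; apply: proj_inv => //; first exact: projK.
exact: upper_proj.
Qed.

Lemma upper_mul b c : upper b -> upper c -> upper (b *m c).
Proof.
move=> tb tc j k kj; rewrite mxE big1 // => l _.
have [lj|lj] := boolP (lt l j); first by rewrite tb ?mul0r.
rewrite tc ?mulr0 //; have [<-//|/lt_total] := eqVneq j l.
by rewrite (negPf lj) orbF; apply: lt_tr.
Qed.

Lemma diag_mul b c k : upper b -> upper c -> (b *m c) k k = b k k * c k k.
Proof.
move=> tb tc; rewrite mxE (bigD1 k) //= big1 ?addr0 // => l /lt_total/orP[] lk.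
  by rewrite tb ?mul0r.
by rewrite tc ?mulr0.
Qed.

Lemma diag_inv b k : b \in unitmx -> upper b -> b k k * invmx b k k = 1.
Proof.
by move=> ub tb; rewrite -diag_mul ?mulmxV ?mxE ?eqxx //; apply: upper_inv.
Qed.

Lemma lower_proj v k : lower v -> v *m proj (lt k) = proj (lt k) *m v *m proj (lt k).
Proof.
move=> tv; apply/matrixP=> j l; rewrite !mul_projE proj_mulE.
have [kl|_] := boolP (lt k l); last by rewrite !mulr0.
have [_|kj] := boolP (lt k j); first by rewrite mul1r.
by rewrite tv ?mulr0 ?mul0r // (lt_nlt kl kj).
Qed.
End Triangular.

(** * The triangular factors and their 2-form *)
Section Factorization.
Variables (F : fieldType) (n : nat) (lt : rel 'I_n).
Hypotheses (ltxx : irreflexive lt) (lt_tr : transitive lt).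
Hypothesis lt_total : forall i j, i != j -> lt i j || lt j i.
Implicit Types (a b u v w X Y Z : 'M[F]_n) (i j k l s : 'I_n).
Local Notation proj := (proj F).
Local Notation gt := (fun i j => lt j i).

Let gtxx : irreflexive gt. Proof. by move=> i; rewrite ltxx. Qed.
Let gt_tr : transitive gt. Proof. by move=> i j k ij jk; apply: lt_tr ij. Qed.
Let gt_total i j : i != j -> gt i j || gt j i.
Proof. by move/lt_total; rewrite orbC. Qed.

Lemma lower_inv v : v \in unitmx -> lower lt v -> lower lt (invmx v).
Proof. exact: (upper_inv gtxx gt_tr gt_total). Qed.

Definition triangular_factors a b v :=
  [/\ b \in unitmx /\ upper lt b, v \in unitmx /\ lower lt v,
      forall k, v k k = 1 & a *m v = b].

Section Factors.
Variables (a b v : 'M[F]_n).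
Hypothesis abv : triangular_factors a b v.
Let bi := invmx b.
Let vi := invmx v.

Let ub : b \in unitmx. Proof. by case: abv => [[]]. Qed.
Let tb : upper lt b. Proof. by case: abv => [[]]. Qed.
Let uv : v \in unitmx. Proof. by case: abv => _ []. Qed.
Let tv : lower lt v. Proof. by case: abv => _ []. Qed.
Let v1 k : v k k = 1. Proof. by case: abv. Qed.
Let avb : a *m v = b. Proof. by case: abv. Qed.
Let aE : a = b *m vi. Proof. by rewrite -avb mulmxK. Qed.
Let tbi : upper lt bi. Proof. exact: upper_inv. Qed.
Let tvi : lower lt vi. Proof. exact: lower_inv. Qed.
Let via : bi *m a = vi. Proof. by rewrite aE mulKmx. Qed.

(** For [e = proj (lt k)], triangularity says [e b = e b e] and [v e = e v e],
    also for the inverses; with these, [v e b^-1] satisfies the four equations of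
    a padded inverse. *)
Lemma factor_padinv k :
  pad (lt k) a \in unitmx /\ padinv (lt k) a = v *m proj (lt k) *m bi.
Proof.
apply: padinv_uniq; set e := proj (lt k).
have ee : e *m e = e by exact: projK.
have eb : e *m b = e *m b *m e by exact: upper_proj.
have ebi : e *m bi = e *m bi *m e by exact: upper_proj.
have ve : v *m e = e *m v *m e by exact: lower_proj.
have vie : vi *m e = e *m vi *m e by exact: lower_proj.
split; rewrite -/e.
- by rewrite !mulmxA -ve.
- by rewrite -[_ *m bi *m e]mulmxA -[v *m e *m (bi *m e)]mulmxA (mulmxA e) -ebi mulmxA.
- by rewrite !mulmxA -(mulmxA e a v) avb -eb -mulmxA mulmxV // mulmx1.
- rewrite -[_ *m bi *m a]mulmxA via -[_ *m vi *m e]mulmxA vie !mulmxA.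
  by rewrite -(mulmxA v e e) ee -!mulmxA (mulmxA e) -vie mulKVmx.
Qed.

Let vi1 k : vi k k = 1.
Proof.
have := diag_mul gt_total k tv tvi.
by rewrite mulmxV // mxE eqxx v1 mul1r.
Qed.

(** By [factor_padinv], [elim_l (lt k) a = b (1 - e) b^-1], and row [k] of
    [b (1 - e)] has only its diagonal entry since [b] is upper triangular. *)
Lemma factor_elim_l m k (l : 'I_m) (X : 'M[F]_(n, m)) :
  (elim_l (lt k) a *m X) k l = b k k * (bi *m X) k l.
Proof.
have -> : elim_l (lt k) a = b *m (1%:M - proj (lt k)) *m bi.
  rewrite elim_lE; have [_ ->] := factor_padinv k; rewrite !mulmxA avb mulmxBr mulmx1.
  by rewrite mulmxBl mulmxV.
rewrite -mulmxA mxE (bigD1 k) //= big1 ?addr0 => [|j jk].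
  by rewrite mulmxBr mulmx1 mxBE mul_projE ltxx mulr0 subr0.
rewrite mulmxBr mulmx1 mxBE mul_projE.
have [/tb->|kj] := boolP (lt j k); first by rewrite mul0r subrr mul0r.
by have:= lt_total jk; rewrite (negPf kj) /= => ->; rewrite mulr1 subrr mul0r.
Qed.

Lemma factor_elim_r m k (l : 'I_m) (X : 'M[F]_(m, n)) :
  (X *m elim_r (lt k) a) l k = (X *m v) l k.
Proof.
have -> : elim_r (lt k) a = v *m ((1%:M - proj (lt k)) *m vi).
  rewrite elim_rE; have [_ ->] := factor_padinv k.
  by rewrite -[_ *m bi *m a]mulmxA via mulmxBl mul1mx mulmxBr mulmxV // mulmxA.
rewrite mulmxA mxE (bigD1 k) //= big1 ?addr0 => [|j jk].
  by rewrite mulmxBl mul1mx mxBE proj_mulE ltxx mul0r subr0 vi1 mulr1.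
rewrite mulmxBl mul1mx mxBE proj_mulE.
have [/tvi->|kj] := boolP (lt j k); first by rewrite mulr0 subrr mulr0.
by have:= lt_total jk; rewrite (negPf kj) /= => ->; rewrite mul1r subrr mulr0.
Qed.

Lemma factor_schur k : schur (lt k) a k k = b k k.
Proof. by rewrite -elim_l_mul factor_elim_l via vi1 mulr1. Qed.

Lemma factor_diag0 k : b k k != 0.
Proof.
apply: contra_eq_neq (diag_inv ltxx lt_tr lt_total k ub tb) => ->.
by rewrite mul0r eq_sym oner_neq0.
Qed.

(** The pivot [schur (lt k) a k k] is [b k k], which cancels the same factor
    produced by row [k] of [elim_l]. *)
Lemma factor_peel k u w (P Q : 'M[F]_n) : P = bi *m u *m v -> Q = bi *m w *m v ->
  peel (lt k) k a u w =
  (P *m proj (lt k) *m Q) k k - (Q *m proj (lt k) *m P) k k.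
Proof.
move=> PE QE; rewrite /peel factor_schur !quadE !factor_elim_r -!mulmxA !factor_elim_l.
have [_ ->] := factor_padinv k.
rewrite -mulrBr mulrC mulKf ?factor_diag0 //.
by rewrite PE QE !mulmxA.
Qed.

(** With [P = beta - alpha] split in its upper and strictly lower parts, the
    trace of [alpha beta'] is a sum over pairs [lt k l] of products of a lower
    entry at [(l, k)] and an upper entry at [(k, l)]; grouped by [k] these are
    the products in [factor_peel]. *)
Lemma factor_trace u w (au bu aw bw : 'M[F]_n) :
    bu - au = bi *m u *m v -> bw - aw = bi *m w *m v ->
    upper lt bu -> upper lt bw ->
    (forall j k, ~~ lt k j -> au j k = 0) -> (forall j k, ~~ lt k j -> aw j k = 0) ->
  \tr (au *m bw - aw *m bu) = \sum_k peel (lt k) k a u w.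
Proof.
move=> PE QE tbu tbw lau law.
have tr_part (x y y' x' : 'M[F]_n) : upper lt y -> upper lt y' ->
    (forall j k, ~~ lt k j -> x j k = 0) -> (forall j k, ~~ lt k j -> x' j k = 0) ->
    \tr (x *m y') = - \sum_k ((y' - x') *m proj (lt k) *m (y - x)) k k.
  move=> ty ty' lx lx'; rewrite mxtrace_mulC -sumrN; apply: eq_bigr => k _.
  rewrite [LHS]mxE [X in - X]mxE -sumrN; apply: eq_bigr => l _.
  rewrite mul_projE !mxBE.
  have [kl|kl] := boolP (lt k l); last by rewrite lx // !(mulr0, mul0r) oppr0.
  by rewrite lx' ?(rel_asym ltxx lt_tr kl) // (ty _ _ kl) subr0 mulr1 sub0r mulrN opprK.
rewrite raddfB /= (tr_part _ _ _ _ tbu tbw lau law) (tr_part _ _ _ _ tbw tbu law lau).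
rewrite opprK addrC -sumrB; apply: eq_bigr => k _.
by rewrite (factor_peel k PE QE).
Qed.

Lemma factor_v l k : v l k = elim_r (lt k) a l k.
Proof. by rewrite -[elim_r _ _]mul1mx factor_elim_r mul1mx. Qed.

End Factors.

(** Column [k] of [v] solves a linear system with the block [lt k] of [a]; this
    closed formula is rational in [a]. *)
Definition vfactor a : 'M[F]_n := \matrix_(l, k) elim_r (lt k) a l k.

Lemma factor_unique a b v : triangular_factors a b v -> v = vfactor a /\ b = a *m vfactor a.
Proof.
move=> abv; have vE : v = vfactor a.
  by apply/matrixP=> l k; rewrite (factor_v abv) mxE.
by split=> //; case: abv => _ _ _ <-; rewrite vE.
Qed.

(** Row [j] of [a *m elim_r (lt k) a] vanishes for [lt k j], so column by column
    [a *m vfactor a] is upper triangular. *)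
Lemma factor_exists a :
    (forall v, lower lt v -> (forall k, v k k = 1) -> v \in unitmx) ->
    a \in unitmx -> (forall k, pad (lt k) a \in unitmx) ->
  triangular_factors a (a *m vfactor a) (vfactor a).
Proof.
move=> unit_tri ua uG.
have NE j k (X : 'M[F]_n) : ~~ lt k j -> (padinv (lt k) a *m X) j k = 0.
  have [<- _ _ _] := padinvP (uG k).
  by rewrite -mulmxA proj_mulE => /negPf->; rewrite mul0r.
have tv : lower lt (vfactor a).
  move=> j k jk; rewrite mxE elim_rE mxBE NE ?(rel_asym ltxx lt_tr jk) // subr0 mxE.
  by case: eqP jk => // ->; rewrite ltxx.
have v1 k : vfactor a k k = 1.
  by rewrite mxE elim_rE mxBE NE ?ltxx // subr0 mxE eqxx.
have uv := unit_tri _ tv v1.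
split=> //; split=> //; first by rewrite unitmx_mul ua.
move=> j k kj; rewrite mxE.
under eq_bigr do rewrite [vfactor _ _ _]mxE.
transitivity ((a *m elim_r (lt k) a) j k); first by rewrite mxE.
rewrite mul_elim_r; transitivity ((proj (lt k) *m schur (lt k) a) j k).
  by rewrite proj_mulE kj mul1r.
have [_ _ eaN _] := padinvP (uG k).
by rewrite schurE mulmxBr !mulmxA eaN subrr mxE.
Qed.
End Factorization.

(** * The exterior derivative as a cubic trace *)
Section CubicTrace.
Variables (F : fieldType) (n : nat) (lt : rel 'I_n).
Hypotheses (ltxx : irreflexive lt) (lt_tr : transitive lt).
Hypothesis lt_total : forall i j, i != j -> lt i j || lt j i.
Implicit Types (a b u v w X Y Z : 'M[F]_n) (i j k l s : 'I_n).

Definition lpart X : 'M[F]_n := \matrix_(j, k) (if lt k j then X j k else 0).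
Definition upart X := X - lpart X.

Definition strict_lower X := forall j k, ~~ lt k j -> X j k = 0.

Lemma lpart_strict X : strict_lower (lpart X).
Proof. by move=> j k /negPf kj; rewrite mxE kj. Qed.

Lemma upart_upper X : upper lt (upart X).
Proof. by move=> j k kj; rewrite mxBE mxE kj subrr. Qed.

Lemma lupart X : lpart X + upart X = X.
Proof. by rewrite addrC subrK. Qed.

Let T X Y Z : F := \tr (X *m Y *m Z).

Let Tcyc X Y Z : T X Y Z = T Y Z X.
Proof. by rewrite /T -mulmxA mxtrace_mulC. Qed.

Lemma trace_lpart X Y : upper lt Y ->
  \tr (lpart X *m Y) = \tr (X *m Y) - \sum_k X k k * Y k k.
Proof.
move=> tY; rewrite -sumrB; apply: eq_bigr => k _.
rewrite [LHS]mxE [X in X - _]mxE (bigD1 k) //= [X in _ = X - _](bigD1 k) //=.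
rewrite mxE ltxx mul0r add0r addrAC subrr add0r; apply: eq_bigr => l lk.
rewrite mxE; case: (boolP (lt l k)) => // kl.
by have := lt_total lk; rewrite (negPf kl) /= => /tY->; rewrite !mulr0.
Qed.

Lemma trace_upart X Z : strict_lower X -> \tr (X *m upart Z) = \tr (X *m Z).
Proof.
move=> lX; rewrite /upart mulmxBr raddfB /= [X in _ - X]big1 ?subr0 // => k _.
rewrite mxE big1 // => l _; rewrite mxE.
have [kl|lk] := boolP (lt k l); last by rewrite mulr0.
by rewrite lX ?mul0r // (rel_asym ltxx lt_tr kl).
Qed.

Lemma mul_strict_diag X X' k : strict_lower X -> strict_lower X' -> (X *m X') k k = 0.
Proof.
move=> lX lX'; rewrite mxE big1 // => l _.
have [kl|kl] := boolP (lt k l); last by rewrite lX' ?mulr0.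
by rewrite lX ?mul0r // (rel_asym ltxx lt_tr kl).
Qed.

Lemma mul_strict X X' : strict_lower X -> strict_lower X' -> strict_lower (X *m X').
Proof.
move=> lX lX' j k kj; rewrite mxE big1 // => l _.
have [lj|lj] := boolP (lt l j); last by rewrite lX ?mul0r.
rewrite lX' ?mulr0 //; apply: contra kj => kl; exact: lt_tr kl lj.
Qed.

Lemma trace_strict3 X Y Z : strict_lower X -> strict_lower Y -> strict_lower Z ->
  \tr (X *m Y *m Z) = 0.
Proof.
by move=> lX lY lZ; apply: big1 => k _; apply: mul_strict_diag => //; apply: mul_strict.
Qed.

Lemma trace_upper3 X Y Z : upper lt X -> upper lt Y -> upper lt Z ->
  \tr (X *m Y *m Z) = \sum_k X k k * Y k k * Z k k.
Proof.
move=> tX tY tZ; apply: eq_bigr => k _.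
rewrite (diag_mul lt_total _ _ tZ) ?(diag_mul lt_total _ tX tY) //.
exact: upper_mul.
Qed.

(** [P i] stands for [b^-1 u_i v] at a point, with [i] ranging over tangent
    vectors, and [X], [Y] for its strictly lower and upper parts. *)
Section Three.
Variables (I : Type) (P X Y : I -> 'M[F]_n).
Hypothesis PE : forall i : I, P i = X i + Y i.
Hypothesis lX : forall i : I, strict_lower (X i).
Hypothesis tY : forall i : I, upper lt (Y i).

(** The derivative of [P j] along [i]: as [b^-1 db = Y] and [v^-1 dv = - X],
    [d (b^-1 u v) = - Y (b^-1 u v) - (b^-1 u v) X]. *)
Let Z (i j : I) := - (Y i *m P j) - P j *m X i.

(** The derivative along [t] of [tr (lpart (P v) upart (P u))]. *)
Definition dtrace (t u v : I) : F :=
  \tr (lpart (Z t v) *m Y u + X v *m upart (Z t u)).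

(** The only part of [dtrace] that is not a trace of three factors: taking the
    lower part of [Z] drops its diagonal. *)
Let d (t v u : I) := \sum_k Z t v k k * Y u k k.

Lemma d_sym (t v u : I) : d t v u = d v t u.
Proof.
apply: eq_bigr => k _; congr (_ * _).
rewrite /Z !mxBE !mxNE [P v]PE [P t]PE !mulmxDr !mulmxDl !mxDE.
rewrite !(mul_strict_diag _ (lX _) (lX _)) !(diag_mul lt_total _ (tY _) (tY _)).
by ring.
Qed.

Lemma dtraceE (t u v : I) : dtrace t u v = - d t v u
  - T (Y t) (X v) (Y u) - T (Y t) (Y v) (Y u) - T (X t) (Y u) (X v)
  - T (X t) (Y u) (Y v) - T (Y t) (X u) (X v) - T (Y t) (Y u) (X v)
  - T (X t) (X v) (X u) - T (X t) (X v) (Y u).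
Proof.
rewrite /dtrace mxtraceD trace_lpart // trace_upart // -/(d t v u).
rewrite /Z [P v]PE [P u]PE !(mulmxDl, mulmxBl, mulmxDr, mulmxBr, mulNmx, mulmxN).
rewrite !(mulmxA, opprD) !(mxtraceD, raddfN) /= -!/(T _ _ _).
rewrite [T (X v) (X t) (Y u)]Tcyc [T (Y v) (X t) (Y u)]Tcyc.
rewrite ![T (X v) _ _]Tcyc.
rewrite [T (X u) _ _]Tcyc [T (Y u) _ _]Tcyc.
by ring.
Qed.

(** The diagonal terms cancel by their symmetry [d_sym], products of three
    strictly lower factors are traceless, and products of three upper factors
    have a symmetric trace; the other terms match the expansion of the right
    hand side. *)
Lemma dtrace_cyclic (t u v : I) :
  (dtrace t u v - dtrace t v u) + (dtrace u v t - dtrace u t v) + (dtrace v t u - dtrace v u t)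
  = \tr (P t *m P v *m P u) - \tr (P t *m P u *m P v).
Proof.
rewrite !dtraceE [P t]PE [P u]PE [P v]PE !(mulmxDl, mulmxDr) !mxtraceD -!/(T _ _ _).
rewrite (d_sym v t u) (d_sym v u t) (d_sym u t v).
have X0 (i j k : I) : T (X i) (X j) (X k) = 0 by apply: trace_strict3.
have YS : T (Y t) (Y v) (Y u) = T (Y t) (Y u) (Y v).
  by rewrite /T !trace_upper3 //; apply: eq_bigr => k _; rewrite mulrAC.
rewrite !X0; do 2 (rewrite ![T (X v) _ _]Tcyc ![T (Y v) _ _]Tcyc;
  rewrite ?[T (X u) _ _]Tcyc ?[T (Y u) _ _]Tcyc).
rewrite YS; ring.
Qed.
End Three.
End CubicTrace.

(** * Differentials of functions and of matrices *)
Section ScalarDiff.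
Variables (K : numFieldType) (V : normedModType K).
Implicit Types (f g : V -> K) (a u : V) (L : V -> K).

Definition has_diff f a L :=
  differentiable (f : V -> K^o) a /\ forall u, 'd (f : V -> K^o) a u = L u.

Lemma has_diff_ex f a : differentiable (f : V -> K^o) a ->
  has_diff f a ('d (f : V -> K^o) a).
Proof. by []. Qed.

Lemma has_diff_unique f a L L' : has_diff f a L -> has_diff f a L' -> L =1 L'.
Proof. by move=> [_ H] [_ H'] u; rewrite -H. Qed.

Lemma has_diff_ext f a L L' : L =1 L' -> has_diff f a L -> has_diff f a L'.
Proof. by move=> LL' [df H]; split=> // u; rewrite -LL'. Qed.

Lemma has_diff_eq f g a L L' :
  f =1 g -> L =1 L' -> has_diff f a L -> has_diff g a L'.
Proof. by move=> /funext-> LL'; apply: has_diff_ext. Qed.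

(** Inverses and triangular factors have closed formulas only near the point, for
    instance where a determinant does not vanish. *)
Lemma has_diff_near f g a L : {near a, f =1 g} -> has_diff f a L -> has_diff g a L.
Proof.
move=> fg [df dfE].
have [cf ef] := (diff_locallyP a (f : V -> K^o)).1 df.
have eg : (g : V -> K^o) \o shift a = cst (g a : K^o) + 'd (f : V -> K^o) a +o_ 0 id.
  apply/eqaddoP => e e0.
  move/eqaddoP : ef => /(_ e e0); apply: filter_app.
  have : \forall h \near 0, f (h + a) = g (h + a).
    by have := near_shift 0 a (fun x => f x = g x); rewrite /= subr0 => <-.
  apply: filterS => h /= E.
  rewrite -[((f : V -> K^o) \o _ - _) h]/((f (h + a) : K^o) - (f a + 'd (f : V -> K^o) a h)).
  rewrite -[((g : V -> K^o) \o _ - _) h]/((g (h + a) : K^o) - (g a + 'd (f : V -> K^o) a h)).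
  by rewrite E (nbhs_singleton fg).
have dE := diff_unique cf eg.
split; last by move=> u; rewrite dE.
by apply/diff_locallyP; rewrite dE.
Qed.

Lemma has_diff_cst (c : K) a : has_diff (fun=> c) a (fun=> 0).
Proof.
split; first exact: (@differentiable_cst _ _ _ (c : K^o)).
by move=> u; rewrite (diff_cst (c : K^o)).
Qed.

Lemma has_diffD f g a L L' : has_diff f a L -> has_diff g a L' ->
  has_diff (fun x => f x + g x) a (fun u => L u + L' u).
Proof.
move=> [df fE] [dg gE]; split; first exact: (differentiableD df dg).
by move=> u; rewrite (diffD df dg) /= fE gE.
Qed.

Lemma has_diffN f a L : has_diff f a L -> has_diff (fun x => - f x) a (fun u => - L u).
Proof.
move=> [df fE]; split; first exact: (differentiableN df).
by move=> u; rewrite -fE (diffN df).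
Qed.

Lemma has_diffB f g a L L' : has_diff f a L -> has_diff g a L' ->
  has_diff (fun x => f x - g x) a (fun u => L u - L' u).
Proof. by move=> Hf Hg; apply: has_diffD => //; apply: has_diffN. Qed.

Lemma has_diffM f g a L L' : has_diff f a L -> has_diff g a L' ->
  has_diff (fun x => f x * g x) a (fun u => L u * g a + f a * L' u).
Proof.
move=> [df fE] [dg gE]; split; first exact: (differentiableM df dg).
move=> u; rewrite -fE -gE (diffM df dg) [_ * g a]mulrC [RHS]addrC.
by [].
Qed.

Lemma has_diffV f a L : f a != 0 -> has_diff f a L ->
  has_diff (fun x => (f x)^-1) a (fun u => - (f a) ^- 2 * L u).
Proof.
move=> f0 [df fE]; split; first exact: (differentiableV df f0).
by move=> u; rewrite -fE (diffV df f0).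
Qed.

Lemma has_diff_sum (I : Type) (r : seq I) (P : pred I) (f L : I -> V -> K) a :
  (forall i, P i -> has_diff (f i) a (L i)) ->
  has_diff (fun x => \sum_(i <- r | P i) f i x) a (fun u => \sum_(i <- r | P i) L i u).
Proof.
move=> H; elim: r => [|i r IH].
  have -> : (fun x => \sum_(i <- [::] | P i) f i x) = fun=> 0 by apply/funext=> x; rewrite big_nil.
  by apply: has_diff_ext (has_diff_cst 0 a) => u; rewrite big_nil.
have -> : (fun x => \sum_(i <- i :: r | P i) f i x) =
    (fun x => (if P i then f i x else 0) + \sum_(i <- r | P i) f i x).
  by apply/funext=> x; rewrite big_cons; case: (P i); rewrite ?add0r.
apply: (@has_diff_ext _ _ (fun u => (if P i then L i u else 0) + \sum_(i <- r | P i) L i u)).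
  by move=> u; rewrite big_cons; case: (P i); rewrite ?add0r.
apply: has_diffD IH.
by case: (boolP (P i)) => [/H//|_]; apply: has_diff_cst.
Qed.

Lemma differentiable_prod (I : Type) (r : seq I) (f : I -> V -> K) a :
  (forall i, differentiable (f i : V -> K^o) a) ->
  differentiable (fun x => \prod_(i <- r) f i x : K^o) a.
Proof.
move=> H; elim: r => [|i r IH].
  under eq_fun do rewrite big_nil.
  exact: (@differentiable_cst _ _ _ (1 : K^o)).
under eq_fun do rewrite big_cons.
exact: (differentiableM (H i) IH).
Qed.

Lemma differentiable_near_neq0 f a : differentiable (f : V -> K^o) a -> f a != 0 ->
  \forall x \near a, f x != 0.
Proof.
move=> /differentiable_continuous cf f0.
exact: cvgr_neq0 (f a) cf f0.
Qed.
End ScalarDiff.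

Section MatrixDiff.
Variables (K : numFieldType) (V : normedModType K).
Implicit Types (a u : V).

Definition mx_diff p q (g : V -> 'M[K]_(p, q)) a (Dg : V -> 'M[K]_(p, q)) :=
  forall i j, has_diff (fun x => g x i j) a (fun u => Dg u i j).

Lemma mx_diff_ext p q (g : V -> 'M[K]_(p, q)) a D D' :
  D =1 D' -> mx_diff g a D -> mx_diff g a D'.
Proof. by move=> DD H i j; apply: has_diff_ext (H i j) => u; rewrite DD. Qed.

Lemma mx_diff_unique p q (g : V -> 'M[K]_(p, q)) a D D' :
  mx_diff g a D -> mx_diff g a D' -> D =1 D'.
Proof.
by move=> H H' u; apply/matrixP=> i j; exact: (has_diff_unique (H i j) (H' i j)).
Qed.

Lemma mx_diff_near p q (f g : V -> 'M[K]_(p, q)) a D :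
  {near a, f =1 g} -> mx_diff f a D -> mx_diff g a D.
Proof.
move=> fg H i j; apply: has_diff_near (H i j).
by apply: filterS fg => x ->.
Qed.

Lemma mx_diff_cst p q (c : 'M[K]_(p, q)) a : mx_diff (fun=> c) a (fun=> 0).
Proof. by move=> i j; apply: has_diff_ext (has_diff_cst _ _) => u; rewrite mxE. Qed.

Lemma mx_diffD p q (f g : V -> 'M[K]_(p, q)) a D D' :
  mx_diff f a D -> mx_diff g a D' ->
  mx_diff (fun x => f x + g x) a (fun u => D u + D' u).
Proof.
move=> H H' i j.
by apply: has_diff_eq (has_diffD (H i j) (H' i j)) => u; rewrite !mxE.
Qed.

Lemma mx_diffB p q (f g : V -> 'M[K]_(p, q)) a D D' :
  mx_diff f a D -> mx_diff g a D' ->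
  mx_diff (fun x => f x - g x) a (fun u => D u - D' u).
Proof.
move=> H H' i j.
by apply: has_diff_eq (has_diffB (H i j) (H' i j)) => u; rewrite !mxE.
Qed.

Lemma mx_diffM p q r (f : V -> 'M[K]_(p, q)) (g : V -> 'M[K]_(q, r)) a D D' :
  mx_diff f a D -> mx_diff g a D' ->
  mx_diff (fun x => f x *m g x) a (fun u => D u *m g a + f a *m D' u).
Proof.
move=> H H' i j.
have S : has_diff (fun x => \sum_k f x i k * g x k j) a
    (fun u => \sum_k (D u i k * g a k j + f a i k * D' u k j)).
  by apply: has_diff_sum => k _; apply: has_diffM.
apply: has_diff_eq S => u.
  by rewrite mxE.
by rewrite !mxE -big_split.
Qed.

Lemma differentiable_det p (g : V -> 'M[K]_p) a :
  (forall i j, differentiable (fun x => g x i j : K^o) a) ->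
  differentiable (fun x => \det (g x) : K^o) a.
Proof.
move=> H.
have Hs (s : 'S_p) : has_diff (fun x => (-1) ^+ s * \prod_i g x i (s i)) a
   ('d (fun x => (-1) ^+ s * \prod_i g x i (s i) : K^o) a).
  apply: has_diff_ex.
  apply: (proj1 (has_diffM (has_diff_cst ((-1) ^+ s) a) (has_diff_ex _))).
  exact: differentiable_prod.
have S : has_diff (fun x => \sum_(s : 'S_p) (-1) ^+ s * \prod_i g x i (s i)) a
   (fun u => \sum_(s : 'S_p) 'd (fun x => (-1) ^+ s * \prod_i g x i (s i) : K^o) a u).
  by apply: has_diff_sum => s _; apply: Hs.
exact: S.1.
Qed.

Lemma mx_diff_near_unit p (g : V -> 'M[K]_p) a D : mx_diff g a D -> g a \in unitmx ->
  \forall x \near a, g x \in unitmx.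
Proof.
move=> H; rewrite unitmxE unitfE => ga.
have := differentiable_near_neq0 (differentiable_det (fun i j => (H i j).1)) ga.
by apply: filterS => x; rewrite unitmxE unitfE.
Qed.

Lemma mx_diff_adj p (g : V -> 'M[K]_p) a D : mx_diff g a D ->
  forall i j, differentiable (fun x => (\adj (g x)) i j : K^o) a.
Proof.
move=> H i j.
rewrite (_ : (fun x => (\adj (g x)) i j : K^o) =
   (fun x => (-1) ^+ (j + i) * \det (row' j (col' i (g x))) : K^o)); last first.
  by apply/funext=> x; rewrite mxE.
apply: (proj1 (has_diffM (has_diff_cst ((-1) ^+ (j + i)) a) (has_diff_ex _))).
apply: differentiable_det => k l.
under eq_fun do rewrite !mxE.
exact: (H _ _).1.
Qed.

(** Differentiability comes from Cramer's rule; the value then follows by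
    differentiating [g g^-1 = 1]. *)
Lemma mx_diff_invmx p (g : V -> 'M[K]_p) a D : mx_diff g a D -> g a \in unitmx ->
  mx_diff (fun x => invmx (g x)) a (fun u => - (invmx (g a) *m D u *m invmx (g a))).
Proof.
move=> H ua.
pose D' u : 'M[K]_p := \matrix_(i, j) 'd (fun x => invmx (g x) i j : K^o) a u.
have H' : mx_diff (fun x => invmx (g x)) a D'.
  move=> i j; apply: (@has_diff_ext _ _ _ _ ('d (fun x => invmx (g x) i j : K^o) a)).
    by move=> u; rewrite mxE.
  apply: has_diff_ex.
  have ua' : \det (g a) != 0 by rewrite -unitfE -unitmxE.
  have dd := has_diff_ex (differentiable_det (fun i j => (H i j).1)).
  have da := has_diff_ex (mx_diff_adj H i j).
  have S := has_diffM (@has_diffV _ _ (fun x => \det (g x)) _ _ ua' dd) da.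
  suff N : {near a, (fun x => (\det (g x))^-1 * (\adj (g x)) i j) =1
                    (fun x => invmx (g x) i j)} by exact: (has_diff_near N S).1.
  apply: filterS (mx_diff_near_unit H ua) => x ux.
  by rewrite /invmx ux mxZE.
apply: (mx_diff_ext _ H') => u.
have E : mx_diff (fun x => g x *m invmx (g x)) a (fun=> 0).
  apply: mx_diff_near (mx_diff_cst 1%:M a).
  by apply: filterS (mx_diff_near_unit H ua) => x ux; rewrite mulmxV.
have /(_ u) /eqP := mx_diff_unique (mx_diffM H H') E.
rewrite addrC addr_eq0 => /eqP /(congr1 (mulmx (invmx (g a)))).
by rewrite mulKmx // mulmxN mulmxA.
Qed.
End MatrixDiff.

Section MatrixValued.
Variables (K : numFieldType) (V : normedModType K).

(** Entrywise differentials assemble to the differential of the matrix-valued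
    map, which is the one that enters [Omega]. *)
Lemma mx_diff_diff p q (g : V -> 'M[K]_(p, q)) a D : mx_diff g a D ->
  differentiable g a /\ forall u, 'd g a u = D u.
Proof.
move=> H.
have dg : differentiable g a.
  rewrite (_ : g = \sum_(i < p) \sum_(j < q) (fun x => g x i j *: delta_mx i j)).
    apply: differentiable_sum => i; apply: differentiable_sum => j.
    exact: (differentiableZl _ (H i j).1).
  apply/funext=> x; rewrite [LHS]matrix_sum_delta fct_sumE.
  by apply: eq_bigr => i _; rewrite fct_sumE.
split=> // u; apply/matrixP=> i j.
have [_ <-] := H i j.
have clin : linear (fun M : 'M[K]_(p, q) => M i j : K^o) by move=> c x y; rewrite !mxE.
pose cL : {linear 'M[K]_(p, q) -> K^o} :=
  HB.pack (fun M : 'M[K]_(p, q) => M i j : K^o) (GRing.isLinear.Build _ _ _ _ _ clin).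
have cc : continuous cL by exact: coord_continuous.
have := diff_comp dg (linear_differentiable (g a) cc).
by rewrite (diff_lin _ cc) => /(congr1 (@^~ u)).
Qed.
End MatrixValued.

(** * The 2-form of one factorization *)
Section OneOrder.
Variables (K : numFieldType) (n : nat) (lt : rel 'I_n).
Hypotheses (ltxx : irreflexive lt) (lt_tr : transitive lt).
Hypothesis lt_total : forall i j, i != j -> lt i j || lt j i.
Hypothesis unit_tri : forall v : 'M[K]_n,
  lower lt v -> (forall k, v k k = 1) -> v \in unitmx.
Implicit Types (a b u v w t X Y Z : 'M[K]_n) (i j k l s : 'I_n) (I : pred 'I_n).

Lemma mx_diff_id a : mx_diff (@id 'M[K]_n) a id.
Proof.
move=> i j; split; first exact: differentiable_coord.
move=> u.
have clin : linear (fun M : 'M[K]_n => M i j : K^o) by move=> c x y; rewrite !mxE.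
pose cL : {linear 'M[K]_n -> K^o} :=
  HB.pack (fun M : 'M[K]_n => M i j : K^o) (GRing.isLinear.Build _ _ _ _ _ clin).
have cc : continuous cL by exact: coord_continuous.
by rewrite [X in X u](diff_lin _ cc).
Qed.

Lemma mx_diff_pad I a : mx_diff (pad I) a (fun u => proj K I *m u *m proj K I).
Proof.
have H := mx_diffM (mx_diffM (mx_diff_cst (proj K I) a) (mx_diff_id a))
  (mx_diff_cst (proj K I) a).
have H' := mx_diffD H (mx_diff_cst (1%:M - proj K I) a).
by apply: (mx_diff_ext _ H') => u; rewrite !(mul0mx, mulmx0, add0r, addr0).
Qed.

Lemma mx_diff_padinv I a : pad I a \in unitmx ->
  mx_diff (padinv I) a (fun u => - (padinv I a *m u *m padinv I a)).
Proof.
move=> uG; have H0 := mx_diff_invmx (mx_diff_pad I a) uG.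
have H := mx_diffM (mx_diffM (mx_diff_cst (proj K I) a) H0)
  (mx_diff_cst (proj K I) a).
rewrite padinv.unlock.
apply: (mx_diff_ext _ H) => u.
by rewrite !(mul0mx, mulmx0, add0r, addr0, mulmxN, mulNmx) !mulmxA.
Qed.

Lemma mx_diff_elim_r I a : pad I a \in unitmx ->
  mx_diff (elim_r I) a (fun u => - (padinv I a *m u *m elim_r I a)).
Proof.
move=> uG; have H := mx_diffB (mx_diff_cst 1%:M a)
  (mx_diffM (mx_diff_padinv uG) (mx_diff_id a)).
rewrite [elim_r I](_ : _ = fun x => 1%:M - padinv I x *m x); last by apply/funext=> x; rewrite elim_rE.
apply: (mx_diff_ext _ H) => u.
by rewrite sub0r mulmxBr mulmx1 mulmxA mulNmx addrC.
Qed.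

Lemma mx_diff_schur I a : pad I a \in unitmx -> mx_diff (schur I) a (dschur I a).
Proof.
move=> uG; have H := mx_diffM (mx_diff_id a) (mx_diff_elim_r uG).
rewrite [schur I](_ : _ = fun x => x *m elim_r I x); last first.
  by apply/funext=> x; rewrite mul_elim_r.
apply: (mx_diff_ext _ H) => u.
by rewrite dschurE elim_lE mulmxN !mulmxBl mul1mx !mulmxA.
Qed.

(** All blocks [lt k] invertible: the open condition that characterizes the
    matrices with a triangular factorization for [lt]. *)
Definition factorable a := a \in unitmx /\ forall k, pad (lt k) a \in unitmx.

Lemma factorable_factors a : factorable a -> triangular_factors lt a (a *m vfactor lt a) (vfactor lt a).
Proof. by case=> ua uG; apply: (factor_exists ltxx lt_tr). Qed.

Lemma factors_factorable a b v : triangular_factors lt a b v -> factorable a.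
Proof.
move=> abv; split; last first.
  by move=> k; case: (factor_padinv ltxx lt_tr lt_total abv k).
by case: abv => [[ub _] [uv _] _ avb]; move: ub; rewrite -avb unitmx_mul uv andbT.
Qed.

Lemma factorable_near a : factorable a -> \forall x \near a, factorable x.
Proof.
case=> ua uG; have := mx_diff_near_unit (mx_diff_id a) ua; apply: filter_app.
pose f k : set 'M[K]_n := fun x => pad (lt k) x \in unitmx.
have : \forall x \near nbhs a, forall k, f k x.
  apply: (@filter_forall _ _ f) => k.
  exact: (mx_diff_near_unit (mx_diff_pad _ a) (uG k)).
by apply: filterS => x Hx ux.
Qed.

Definition dvfactor a u : 'M[K]_n :=
  \matrix_(l, k) (- (padinv (lt k) a *m u *m elim_r (lt k) a)) l k.

Lemma mx_diff_vfactor a : factorable a -> mx_diff (vfactor lt) a (dvfactor a).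
Proof.
case=> _ uG l k; have := mx_diff_elim_r (uG k) l k.
by apply: has_diff_eq => x; rewrite [RHS]mxE.
Qed.

Lemma strict_dvfactor a u : factorable a -> strict_lower lt (dvfactor a u).
Proof.
case=> _ uG l k /negPf kl; rewrite mxE mxNE.
have [<- _ _ _] := padinvP (uG k).
by rewrite -!mulmxA proj_mulE kl mul0r oppr0.
Qed.

Definition bfactor a := a *m vfactor lt a.
Definition dbfactor a u := u *m vfactor lt a + a *m dvfactor a u.

Lemma mx_diff_bfactor a : factorable a -> mx_diff bfactor a (dbfactor a).
Proof. by move=> /mx_diff_vfactor; apply: mx_diffM (mx_diff_id a). Qed.

Lemma upper_dbfactor a u : factorable a -> upper lt (dbfactor a u).
Proof.
move=> ga j k kj.
have H : has_diff (fun x => bfactor x j k) a (fun=> 0).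
  apply: has_diff_near (has_diff_cst 0 a).
  by apply: filterS (factorable_near ga) => x /factorable_factors[[_ ->]].
exact: (has_diff_unique (mx_diff_bfactor ga j k) H u).
Qed.

(** The tangent vector [u] in the frame of the two factors: this is the matrix
    [P] whose triangular parts are the logarithmic differentials. *)
Definition framed a u := invmx (bfactor a) *m u *m vfactor lt a.

Lemma lupart_unique X Y P : strict_lower lt X -> upper lt Y -> Y - X = P ->
  lpart lt P = - X /\ upart lt P = Y.
Proof.
move=> lX tY <-; have E : lpart lt (Y - X) = - X.
  apply/matrixP=> j k; rewrite mxE mxBE mxNE.
  by case: ifP => [/tY->|/negbT/lX->]; rewrite ?sub0r ?oppr0.
by split=> //; rewrite /upart E opprK subrK.
Qed.

(** [d (a v) = u v + a dv] multiplied by [b^-1] on the left gives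
    [b^-1 db - v^-1 dv = framed a u]; the first term is upper and the second
    strictly lower, so they are the parts of [framed a u]. *)
Lemma logd_parts a u : factorable a ->
  invmx (vfactor lt a) *m dvfactor a u = - lpart lt (framed a u) /\
  invmx (bfactor a) *m dbfactor a u = upart lt (framed a u).
Proof.
move=> ga; have abv := factorable_factors ga; have [[ub tb] [uv tv] v1 avb] := abv.
have lX : strict_lower lt (invmx (vfactor lt a) *m dvfactor a u).
  have tvi := lower_inv ltxx lt_tr lt_total uv tv.
  move=> j k kj; rewrite mxE big1 // => l _.
  have [kl|kl] := boolP (lt k l); last by rewrite strict_dvfactor ?mulr0.
  by rewrite tvi ?mul0r //; exact: (lt_nlt lt_tr lt_total kl kj).
have tY : upper lt (invmx (bfactor a) *m dbfactor a u).
  apply: (upper_mul lt_tr lt_total); last exact: upper_dbfactor.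
  exact: (upper_inv ltxx lt_tr lt_total).
have E : invmx (bfactor a) *m dbfactor a u - invmx (vfactor lt a) *m dvfactor a u = framed a u.
  have bia : invmx (bfactor a) *m a = invmx (vfactor lt a).
    by rewrite -[LHS](mulmxK uv) -[_ *m a *m _]mulmxA mulVmx // mul1mx.
  by rewrite /dbfactor mulmxDr !mulmxA bia addrK.
by have [-> ->] := lupart_unique lX tY E; rewrite opprK.
Qed.

(** [tr (v^-1 dv /\ b^-1 db)] after substitution of [logd_parts]. *)
Definition factor_form a u w :=
  \tr (lpart lt (framed a w) *m upart lt (framed a u)) -
  \tr (lpart lt (framed a u) *m upart lt (framed a w)).

Lemma factor_form_peel a u w : factorable a -> factor_form a u w = \sum_k peel (lt k) k a u w.
Proof.
move=> ga; have abv := factorable_factors ga.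
rewrite -(factor_trace ltxx lt_tr lt_total abv (u := u) (w := w)
  (au := - lpart lt (framed a u)) (bu := upart lt (framed a u))
  (aw := - lpart lt (framed a w)) (bw := upart lt (framed a w))).
- by rewrite !mulNmx opprK addrC raddfB.
- by rewrite opprK subrK.
- by rewrite opprK subrK.
- exact: upart_upper.
- exact: upart_upper.
- by move=> j k kj; rewrite mxNE (lpart_strict _ kj) oppr0.
- by move=> j k kj; rewrite mxNE (lpart_strict _ kj) oppr0.
Qed.

Lemma trwedge_factor_form (x y : 'M[K]_n -> 'M[K]_n) a u w : factorable a ->
    x =1 (fun u => invmx (vfactor lt a) *m dvfactor a u) ->
    y =1 (fun u => invmx (bfactor a) *m dbfactor a u) ->
  trwedge x y u w = factor_form a u w.
Proof.
move=> ga xE yE; rewrite /trwedge !xE !yE.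
have [-> ->] := logd_parts u ga; have [-> ->] := logd_parts w ga.
by rewrite !mulNmx opprK addrC raddfB.
Qed.

Definition dframed a t u :=
  - (upart lt (framed a t) *m framed a u) - framed a u *m lpart lt (framed a t).

Lemma mx_diff_framed a u : factorable a -> mx_diff (framed^~ u) a (fun t => dframed a t u).
Proof.
move=> ga; have abv := factorable_factors ga; have [[ub tb] [uv tv] v1 avb] := abv.
have H := mx_diffM (mx_diffM (mx_diff_invmx (mx_diff_bfactor ga) ub) (mx_diff_cst u a))
  (mx_diff_vfactor ga).
apply: (mx_diff_ext _ H) => t; have [vE bE] := logd_parts t ga.
rewrite /dframed -bE -[lpart _ _]opprK -vE mulmx0 addr0 mulmxN opprK /framed.
by rewrite !mulNmx !mulmxA mulmxK // -!/(bfactor a).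
Qed.

Lemma mx_diff_lpart (g : 'M[K]_n -> 'M[K]_n) a D : mx_diff g a D ->
  mx_diff (fun x => lpart lt (g x)) a (fun u => lpart lt (D u)).
Proof.
move=> H j k; case: (boolP (lt k j)) => kj.
  by apply: has_diff_eq (H j k) => x; rewrite mxE kj.
by apply: has_diff_eq (has_diff_cst 0 a) => x; rewrite mxE (negPf kj).
Qed.

Lemma mx_diff_trace (g : 'M[K]_n -> 'M[K]_n) a D : mx_diff g a D ->
  has_diff (fun x => \tr (g x)) a (fun u => \tr (D u)).
Proof. by move=> H; apply: has_diff_sum => k _; apply: H. Qed.

Lemma has_diff_factor_form a u w : factorable a -> has_diff (fun x => factor_form x u w) a
  (fun t =>
     let dtr := dtrace lt (framed a) (fun u => lpart lt (framed a u))
                  (fun u => upart lt (framed a u)) in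
     dtr t u w - dtr t w u).
Proof.
move=> ga.
have Hl y := mx_diff_lpart (mx_diff_framed y ga).
have Hu y : mx_diff (fun x => upart lt (framed x y)) a (fun t => upart lt (dframed a t y)).
  exact: mx_diffB (mx_diff_framed y ga) (Hl y).
have H y z := mx_diff_trace (mx_diffM (Hl y) (Hu z)).
by apply: has_diff_ext (has_diffB (H w u) (H u w)).
Qed.

(** [framed a u] is conjugate by [v] to [a^-1 u]; so the exterior derivative,
    a cubic trace, does not remember the order. *)
Lemma factor_form_cyclic a u v t : factorable a ->
  'd (fun x => factor_form x v t : K^o) a u - 'd (fun x => factor_form x u t : K^o) a v
    + 'd (fun x => factor_form x u v : K^o) a t
  = let Q u := invmx a *m u in
    \tr (Q t *m Q v *m Q u) - \tr (Q t *m Q u *m Q v).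
Proof.
move=> ga /=; have abv := factorable_factors ga; have [[ub tb] [uv tv] v1 avb] := abv.
rewrite [X in X - _ + _](has_diff_factor_form v t ga).2 [X in _ - X + _](has_diff_factor_form u t ga).2.
rewrite [X in _ - _ + X](has_diff_factor_form u v ga).2.
have bi : invmx (bfactor a) = invmx (vfactor lt a) *m invmx a.
  rewrite -[RHS](mulmxK ub) -[_ *m invmx a *m _]mulmxA mulKmx ?mulVmx ?mul1mx //.
  exact: ga.1.
have PE y : framed a y = invmx (vfactor lt a) *m (invmx a *m y) *m vfactor lt a.
  by rewrite /framed bi !mulmxA.
have TP x y z : \tr (framed a x *m framed a y *m framed a z) =
   \tr (invmx a *m x *m (invmx a *m y) *m (invmx a *m z)).
  rewrite !PE !mulmxA mxtrace_mulC !mulmxA mulmxV // mul1mx.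
  by rewrite -!mulmxA !(mulKVmx uv).
rewrite -!TP -(dtrace_cyclic ltxx lt_tr lt_total (P := framed a)
   (X := fun u => lpart lt (framed a u)) (Y := fun u => upart lt (framed a u))).
- have R (x1 x2 x3 x4 x5 x6 : K) :
    x1 - x2 - (x3 - x4) + (x5 - x6) = x5 - x6 + (x1 - x2) + (x4 - x3) by ring.
  exact: R.
- by move=> i; rewrite lupart.
- by move=> i; apply: lpart_strict.
- by move=> i; apply: upart_upper.
Qed.

End OneOrder.

(** * The set GLstar and the form Omega *)
Section Normalize.
Variables (F : fieldType) (n : nat) (lt : rel 'I_n).
Hypotheses (ltxx : irreflexive lt) (lt_tr : transitive lt).
Hypothesis lt_total : forall i j, i != j -> lt i j || lt j i.

(** The diagonal of the lower factor is moved into the upper one. *)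
Lemma normalize_factors (b c : 'M[F]_n) : b \in unitmx -> upper lt b ->
  c \in unitmx -> lower lt c -> exists b' v, triangular_factors lt (b *m c) b' v.
Proof.
move=> ub tb uc tc.
pose d : 'M[F]_n := diag_mx (\row_k c k k).
have gtot i j : i != j -> lt j i || lt i j by move/lt_total; rewrite orbC.
have ttc : upper (fun i j => lt j i) c by [].
have gtr : transitive (fun i j => lt j i) by move=> i j k ij jk; apply: lt_tr ij.
have gxx : irreflexive (fun i j => lt j i) by move=> i; rewrite ltxx.
have c0 k := diag_inv gxx gtr gtot k uc ttc.
have ud : d \in unitmx.
  rewrite unitmxE det_diag unitfE; apply/prodf_neq0 => k _; rewrite mxE.
  by apply: contra_eq_neq (c0 k) => ->; rewrite mul0r eq_sym oner_neq0.
exists (b *m d), (invmx c *m d); split.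
- split; first by rewrite unitmx_mul ub.
  by move=> j k kj; rewrite /d mul_mx_diag mxE tb ?mul0r.
- split; first by rewrite unitmx_mul unitmx_inv uc.
  have tci := lower_inv ltxx lt_tr lt_total uc tc.
  by move=> j k jk; rewrite /d mul_mx_diag mxE tci ?mul0r.
- by move=> k; rewrite /d mul_mx_diag mxE [X in _ * X]mxE mulrC.
- by rewrite -mulmxA mulKVmx.
Qed.
End Normalize.

Section Star.
Variables (K : numFieldType) (n : nat).
Implicit Types (a b c u v w t : 'M[K]_n).

Definition lt_ord : rel 'I_n := fun i j => (i < j)%N.
Definition gt_ord : rel 'I_n := fun i j => (j < i)%N.

Lemma lt_ordxx : irreflexive lt_ord. Proof. by move=> i; rewrite /lt_ord ltnn. Qed.
Lemma gt_ordxx : irreflexive gt_ord. Proof. by move=> i; rewrite /gt_ord ltnn. Qed.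
Lemma lt_ord_tr : transitive lt_ord. Proof. by move=> j i k; apply: ltn_trans. Qed.
Lemma gt_ord_tr : transitive gt_ord.
Proof. by move=> j i k ji kj; apply: ltn_trans kj ji. Qed.
Lemma lt_ord_total i j : i != j -> lt_ord i j || lt_ord j i.
Proof. by move=> ij; rewrite /lt_ord -neq_ltn. Qed.
Lemma gt_ord_total i j : i != j -> gt_ord i j || gt_ord j i.
Proof. by move=> ij; rewrite /gt_ord orbC -neq_ltn. Qed.

Lemma lt_ord_unit (v : 'M[K]_n) : lower lt_ord v -> (forall k, v k k = 1) -> v \in unitmx.
Proof.
move=> tv v1; rewrite unitmxE det_trig; last by apply/is_trig_mxP => i j; apply: tv.
by rewrite big1 ?unitr1 // => i _; rewrite v1.
Qed.

Lemma gt_ord_unit (v : 'M[K]_n) : lower gt_ord v -> (forall k, v k k = 1) -> v \in unitmx.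
Proof.
move=> tv v1; rewrite -unitmx_tr; apply: lt_ord_unit => [i j ij|k]; rewrite mxE //.
exact: tv.
Qed.

Let gfp := factorable_factors lt_ordxx lt_ord_tr lt_ord_unit.
Let gfm := factorable_factors gt_ordxx gt_ord_tr gt_ord_unit.

Lemma GLstarE a : GLstar a <-> factorable lt_ord a /\ factorable gt_ord a.
Proof.
split=> [[[b [c [[ub tb] [uc tc] ->]]] H2]|[gp gm]].
  have [b1 [v1 f1]] := normalize_factors lt_ordxx lt_ord_tr lt_ord_total ub tb uc tc.
  split; first exact: (factors_factorable lt_ordxx lt_ord_tr lt_ord_total f1).
  case: H2 => b' [c' [[ub' tb'] [uc' tc'] ->]].
  have [b2 [v2 f2]] := normalize_factors gt_ordxx gt_ord_tr gt_ord_total ub' tb' uc' tc'.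
  exact: (factors_factorable gt_ordxx gt_ord_tr gt_ord_total f2).
split.
  have [[ub tb] [uv tv] _ avb] := gfp gp.
  exists (a *m vfactor lt_ord a), (invmx (vfactor lt_ord a)); split=> //.
  - split; first by rewrite unitmx_inv.
    exact: (lower_inv lt_ordxx lt_ord_tr lt_ord_total uv tv).
  - by rewrite mulmxK.
have [[ub tb] [uv tv] _ avb] := gfm gm.
exists (a *m vfactor gt_ord a), (invmx (vfactor gt_ord a)); split=> //.
- split; first by rewrite unitmx_inv.
  exact: (lower_inv gt_ordxx gt_ord_tr gt_ord_total uv tv).
- by rewrite mulmxK.
Qed.

Lemma factor_plusE a : factorable lt_ord a -> factor_plus a = (bfactor lt_ord a, vfactor lt_ord a).
Proof.
move=> ga; have [[ub tb] [uv tv] v1 avb] := gfp ga.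
apply: xget_unique => [|[b v] /= [[ub' tb'] [[uv' tv'] v1'] aE]].
  by split=> //; rewrite /= mulmxK.
have f : triangular_factors lt_ord a b v by split=> //; rewrite aE mulmxKV.
by have [-> ->] := factor_unique lt_ordxx lt_ord_tr lt_ord_total f.
Qed.

Lemma factor_minusE a : factorable gt_ord a -> factor_minus a = (bfactor gt_ord a, vfactor gt_ord a).
Proof.
move=> ga; have [[ub tb] [uv tv] v1 avb] := gfm ga.
apply: xget_unique => [|[b v] /= [[ub' tb'] [[uv' tv'] v1'] aE]].
  by split=> //; rewrite /= mulmxK.
have f : triangular_factors gt_ord a b v by split=> //; rewrite aE mulmxKV.
by have [-> ->] := factor_unique gt_ordxx gt_ord_tr gt_ord_total f.
Qed.

Lemma logd_near (g h : 'M[K]_n -> 'M[K]_n) a D : {near a, h =1 g} ->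
  mx_diff h a D -> logd g a =1 fun u => invmx (h a) *m D u.
Proof.
move=> gh H u; rewrite /logd (nbhs_singleton gh).
by have [_ ->] := mx_diff_diff (mx_diff_near gh H).
Qed.

Lemma OmegaE a u w : GLstar a -> Omega a u w = factor_form lt_ord a u w - factor_form gt_ord a u w.
Proof.
case/GLstarE=> gp gm; have np := factorable_near gp; have nm := factorable_near gm.
rewrite /Omega; congr (_ - _).
  apply: (trwedge_factor_form lt_ordxx lt_ord_tr lt_ord_total lt_ord_unit) => //.
    apply: logd_near (mx_diff_vfactor gp); apply: filterS np => x gx.
    by rewrite /vplus factor_plusE.
  apply: logd_near (mx_diff_bfactor gp); apply: filterS np => x gx.
  by rewrite /aplus factor_plusE.
apply: (trwedge_factor_form gt_ordxx gt_ord_tr gt_ord_total gt_ord_unit) => //.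
  apply: logd_near (mx_diff_vfactor gm); apply: filterS nm => x gx.
  by rewrite /vminus factor_minusE.
apply: logd_near (mx_diff_bfactor gm); apply: filterS nm => x gx.
by rewrite /aminus factor_minusE.
Qed.

Lemma GLstar_near a : GLstar a -> \forall x \near a, GLstar x.
Proof.
case/GLstarE=> /factorable_near gp /factorable_near gm.
by apply: filter_app gp; apply: filterS gm => x gm gp; apply/GLstarE.
Qed.

(** By [factor_form_cyclic], both terms of [Omega] have the same exterior
    derivative. *)
Lemma closed_Omega : closed_on GLstar (@Omega K n).
Proof.
move=> a sa; have [gp gm] := (GLstarE a).1 sa.
have H u v : has_diff (fun x => Omega x u v) a
   (fun t => 'd (fun x => factor_form lt_ord x u v : K^o) a t
             - 'd (fun x => factor_form gt_ord x u v : K^o) a t).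
  apply: has_diff_near (has_diffB (has_diff_ex _) (has_diff_ex _)).
  - by apply: filterS (GLstar_near sa) => x sx; rewrite OmegaE.
  - exact: (has_diff_factor_form lt_ordxx lt_ord_tr lt_ord_total lt_ord_unit u v gp).1.
  - exact: (has_diff_factor_form gt_ordxx gt_ord_tr gt_ord_total gt_ord_unit u v gm).1.
split=> [u v|u v t]; first exact: (H u v).1.
rewrite [X in X - _ + _](H v t).2 [X in _ - X + _](H u t).2 [X in _ - _ + X](H u v).2.
have R (p1 p2 p3 m1 m2 m3 : K) : p1 - p2 + p3 = m1 - m2 + m3 ->
    p1 - m1 - (p2 - m2) + (p3 - m3) = 0.
  by move=> /eqP; rewrite -subr_eq0 => /eqP <-; ring.
apply: R; apply: etrans (factor_form_cyclic lt_ordxx lt_ord_tr lt_ord_total lt_ord_unit u v t gp) _.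
exact: esym (factor_form_cyclic gt_ordxx gt_ord_tr gt_ord_total gt_ord_unit u v t gm).
Qed.
End Star.

(** * Telescoping over intervals of indices *)
Section Telescope.
Variables (F : fieldType) (n : nat).
Implicit Types (a b c u v w t : 'M[F]_n) (i j k : 'I_n).

(** Bounds are natural numbers so that the interval may end at [n]. *)
Definition itv (p q : nat) : pred 'I_n := fun k => (p <= k < q)%N.

(** The denominators of the forms of the pair [i < j] do not vanish. *)
Definition regular i j a :=
  let S := schur (itv i.+1 j) a in
  [/\ pad (itv i.+1 j) a \in unitmx, S i i != 0 /\ S j j != 0,
      S i j != 0 /\ S j i != 0 & S i i * S j j - S i j * S j i != 0].

Lemma peel_empty p k a u w : peel (itv p p) k a u w = 0.
Proof.
have p0 : proj F (itv p p) = 0.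
  rewrite proj.unlock; apply/matrixP=> i j; rewrite !mxE /itv.
  by rewrite [(_ <= _ < _)%N](_ : _ = false) ?mul0rn //; case: leqP.
rewrite /peel !quadE (_ : padinv (itv p p) a = 0) ?mulmx0 ?mul0mx ?mxE ?subrr ?mul0r //.
by rewrite padinv.unlock p0 !mul0mx.
Qed.

(** With [U i m], resp. [D j m], the contribution of the interval that starts
    after [i] and ends before [m], resp. starts at [m] and ends before [j], the
    form of the pair [i < j] is the second difference
    [U i (j + 1) - U i j - (D j i - D j (i + 1))].  The sum over [j] telescopes
    the first half to the full interval above [i], and the sum over [i]
    telescopes the second half to the full interval below [j]. *)
Lemma peel_telescope a u w : (forall i j, (i < j)%N -> regular i j a) ->
  \sum_k peel (lt_ord k) k a u w - \sum_k peel (gt_ord k) k a u w =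
  \sum_(p : 'I_n * 'I_n | (p.1 < p.2)%N)
    (p_form (itv p.1.+1 p.2) p.1 p.2 a u * q_form (itv p.1.+1 p.2) p.1 p.2 a w -
     p_form (itv p.1.+1 p.2) p.1 p.2 a w * q_form (itv p.1.+1 p.2) p.1 p.2 a u).
Proof.
move=> H.
pose U i m := peel (itv i.+1 m) i a u w.
pose D j m := peel (itv m j) j a u w.
transitivity (\sum_(p : 'I_n * 'I_n | (p.1 < p.2)%N)
   (U p.1 p.2.+1 - U p.1 p.2 - (D p.2 p.1 - D p.2 p.1.+1))); last first.
  apply: eq_bigr => -[i j] /= ij; have [uG [x0 t0] [y0 z0] D0] := H _ _ ij.
  apply: second_difference => //.
  - by rewrite neq_ltn ij.
  - by rewrite /itv ltnn.
  - by rewrite /itv ltnn andbF.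
  - move=> k; rewrite /itv -val_eqE /=.
    case: (ltngtP i k) => [//|//|ik].
    by rewrite -ik ij.
  - move=> k; rewrite /itv -val_eqE /= ltnS.
    case: (ltngtP k j) => [//|//|kj].
    by rewrite kj ij.
rewrite sumrB; congr (_ - _).
  rewrite -(pair_big_dep predT (fun i j => (i < j)%N) (fun i j : 'I_n => U i j.+1 - U i j)) /=.
  apply: eq_bigr => i _.
  transitivity (\sum_(i.+1 <= j < n) (U i j.+1 - U i j)); last by rewrite big_geq_mkord.
  rewrite telescope_sumr // /U peel_empty subr0; congr (peel _ _ _ _ _).
  by apply/funext=> k; rewrite /lt_ord /itv ltn_ord andbT.
rewrite -(pair_big_dep predT (fun i j => (i < j)%N) (fun i j : 'I_n => D j i - D j i.+1)) /=.
rewrite (exchange_big_dep predT) //=; apply: eq_bigr => j _.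
transitivity (\sum_(0 <= i < val j) (D j i - D j i.+1)); last first.
  rewrite big_mkord (big_ord_widen n (fun i : nat => D j i - D j i.+1)) //.
  exact: ltnW (ltn_ord j).
rewrite -[RHS]opprK -sumrN.
under [X in - X]eq_bigr do rewrite opprB.
rewrite telescope_sumr // /D peel_empty sub0r opprK; congr (peel _ _ _ _ _).
Qed.
End Telescope.

(** * The polynomials in the entries *)
Section Polynomials.
Variables (K : numFieldType) (n : nat).
Implicit Types (a b c u v w t : 'M[K]_n) (i j k : 'I_n) (I : pred 'I_n).
Local Notation MP := (mpoly.mpoly (n * n) K).

Definition pev (P : MP) a : K := mpoly.meval (mx_coord a) P.

(** The generic matrix, whose entries are the coordinate functions. *)
Definition coordmx : 'M[MP]_n :=
  \matrix_(i, j) mpoly.mpolyX K (mpoly.mnm1 (mxvec_index i j)).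

Definition constmx (c : 'M[K]_n) : 'M[MP]_n := map_mx (@mpoly.mpolyC (n * n) K) c.

Lemma pev_coordmx a : map_mx (mpoly.meval (mx_coord a)) coordmx = a.
Proof. by apply/matrixP=> i j; rewrite !mxE mpoly.mevalXU /mx_coord mxvecE. Qed.

Lemma pev_constmx a c : map_mx (mpoly.meval (mx_coord a)) (constmx c) = c.
Proof. by apply/matrixP=> i j; rewrite !mxE mpoly.mevalC. Qed.

Definition padX I : 'M[MP]_n :=
  constmx (proj K I) *m coordmx *m constmx (proj K I) + constmx (1%:M - proj K I).

Lemma pev_padX I a : map_mx (mpoly.meval (mx_coord a)) (padX I) = pad I a.
Proof. by rewrite map_mxD !map_mxM /= !pev_constmx pev_coordmx. Qed.

(** The Schur complement with its denominator [\det (pad I a)] cleared, so that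
    it is polynomial in [a]. *)
Definition adj_schur I a : 'M[K]_n :=
  \det (pad I a) *: a - a *m (proj K I *m \adj (pad I a) *m proj K I) *m a.

Definition adj_schurX I : 'M[MP]_n :=
  \det (padX I) *: coordmx - coordmx *m
    (constmx (proj K I) *m \adj (padX I) *m constmx (proj K I)) *m coordmx.

Lemma pev_detX I a : pev (\det (padX I)) a = \det (pad I a).
Proof. by rewrite /pev -det_map_mx pev_padX. Qed.

Lemma pev_adj_schurX I a k l : pev (adj_schurX I k l) a = adj_schur I a k l.
Proof.
have E : map_mx (mpoly.meval (mx_coord a)) (adj_schurX I) = adj_schur I a.
  rewrite map_mxB map_mxZ !map_mxM /= map_mx_adj -det_map_mx pev_padX.
  by rewrite pev_coordmx pev_constmx.
by rewrite -E [RHS]mxE.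
Qed.

Lemma adj_schurE I a : pad I a \in unitmx -> adj_schur I a = \det (pad I a) *: schur I a.
Proof.
move=> uG.
have adjE : \adj (pad I a) = \det (pad I a) *: invmx (pad I a).
  by rewrite /invmx uG scalerA mulfV ?scale1r // -unitfE -unitmxE.
rewrite /adj_schur adjE schurE scalerBr padinv.unlock -scalemxAr -scalemxAl -scalemxAr.
by rewrite -scalemxAl.
Qed.

Definition schur_minor I i j : MP :=
  adj_schurX I i i * adj_schurX I j j - adj_schurX I i j * adj_schurX I j i.

(** Up to sign and powers of the first polynomial, these are the
    minors of [a] on the open interval between [i] and [j] bordered by [i], [j] or both. *)
Definition minors i j : seq MP :=
  let I := itv i.+1 j in
  [:: \det (padX I); adj_schurX I i i; adj_schurX I j j; adj_schurX I i j; adj_schurX I j i;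
      schur_minor I i j].

Lemma pev_schur_minor I i j a : pev (schur_minor I i j) a =
  adj_schur I a i i * adj_schur I a j j - adj_schur I a i j * adj_schur I a j i.
Proof. by rewrite /pev mpoly.mevalB !mpoly.mevalM -!/(pev _ _) !pev_adj_schurX. Qed.

Lemma regularP i j a : (forall P, P \in minors i j -> pev P a != 0) -> regular i j a.
Proof.
move=> H; set I : pred 'I_n := itv i.+1 j.
have uG : pad I a \in unitmx.
  by rewrite unitmxE unitfE -pev_detX H // !inE eqxx.
have E k l : schur I a k l = (\det (pad I a))^-1 * adj_schur I a k l.
  by rewrite adj_schurE // mxZE mulKf // -unitfE -unitmxE.
have d0 : (\det (pad I a))^-1 != 0 by rewrite invr_eq0 -unitfE -unitmxE.
have H1 : adj_schur I a i i != 0 by rewrite -pev_adj_schurX H // !inE eqxx ?orbT.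
have H2 : adj_schur I a j j != 0 by rewrite -pev_adj_schurX H // !inE eqxx ?orbT.
have H3 : adj_schur I a i j != 0 by rewrite -pev_adj_schurX H // !inE eqxx ?orbT.
have H4 : adj_schur I a j i != 0 by rewrite -pev_adj_schurX H // !inE eqxx ?orbT.
have H5 : pev (schur_minor I i j) a != 0 by rewrite H // !inE eqxx ?orbT.
split; rewrite ?E ?mulf_neq0 //.
rewrite mulrACA [X in _ - X]mulrACA -mulrBr mulf_neq0 // ?mulf_neq0 //.
by rewrite -pev_schur_minor.
Qed.

Lemma pad_diag I a : (forall i j, I i -> I j -> a i j = (i == j)%:R) -> pad I a = 1%:M.
Proof.
move=> H; apply/matrixP=> k l; rewrite /pad mxDE mul_projE proj_mulE mxBE proj.unlock !mxE.
have [<-|kl] := eqVneq k l; rewrite ?mulr0n ?mulr1n.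
  case: (boolP (I k)) => Ik; last by rewrite mulr0 add0r subr0.
  by rewrite H // eqxx !mulr1 subrr addr0.
rewrite subrr addr0; case: (boolP (I k)) => Ik; last by rewrite !mul0r.
case: (boolP (I l)) => Il; last by rewrite mulr0.
by rewrite H // (negPf kl) mulr0 mul0r.
Qed.

Lemma padinv_diag I a : (forall i j, I i -> I j -> a i j = (i == j)%:R) ->
  padinv I a = proj K I.
Proof. by move=> /pad_diag H; rewrite padinv.unlock H invmx1 mulmx1 projK. Qed.

Lemma adj_schur_diag I a k l : (forall i j, I i -> I j -> a i j = (i == j)%:R) ->
  adj_schur I a k l = a k l - \sum_(j | I j) a k j * a j l.
Proof.
move=> H; rewrite adj_schurE ?pad_diag ?unitmx1 // det1 scale1r schurE padinv_diag // mxBE.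
rewrite [X in _ - X = _]mxE [in RHS]big_mkcond; congr (_ - _); apply: eq_bigr => j _.
by rewrite mul_projE; case: (I j); rewrite ?mulr1 // mulr0 mul0r.
Qed.

(** At the identity matrix the determinants of principal blocks do not vanish;
    for the entry at [(k, l)], off the diagonal, the matrix [1 + E_kl] does it. *)
Lemma minors_nonzero i j : (i < j)%N -> forall P, P \in minors i j ->
  exists a, pev P a != 0.
Proof.
move=> ij; set I : pred 'I_n := itv i.+1 j.
have Ii : ~~ I i by rewrite /I /itv ltnn.
have Ij : ~~ I j by rewrite /I /itv ltnn andbF.
have nij : i != j by rewrite neq_ltn ij.
have nji : j != i by rewrite eq_sym.
pose one : 'M[K]_n := 1%:M.
have d1 : forall i j, I i -> I j -> one i j = (i == j)%:R by move=> k l _ _; rewrite mxE.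
have c1 k l : k \in [:: i; j] -> l \in [:: i; j] -> adj_schur I one k l = (k == l)%:R.
  move=> kij lij; rewrite adj_schur_diag // big1 ?subr0 ?mxE // => m Im.
  rewrite !mxE [k == m](_ : _ = false) ?mul0r //; apply: contraTF Im => /eqP<-.
  by move: kij; rewrite !inE => /orP[]/eqP->.
have e k l : k != l -> k \in [:: i; j] -> l \in [:: i; j] ->
    exists a, adj_schur I a k l != 0.
  move=> kl kij lij; exists (one + delta_mx k l).
  rewrite adj_schur_diag => [|p q Ip Iq].
    rewrite !mxE (negPf kl) !eqxx add0r big1 ?subr0 ?oner_neq0 // => m Im.
    rewrite !mxE [k == m](_ : _ = false) ?add0r ?eqxx.
      rewrite [m == l](_ : _ = false) ?andbF ?mul0r //.
      by apply: contraTF Im => /eqP->; move: lij; rewrite !inE => /orP[]/eqP->.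
    by apply: contraTF Im => /eqP<-; move: kij; rewrite !inE => /orP[]/eqP->.
  rewrite !mxE [p == k](_ : _ = false) ?addr0 //.
  by apply: contraTF Ip => /eqP->; move: kij; rewrite !inE => /orP[]/eqP->.
have mi : i \in [:: i; j] by rewrite inE eqxx.
have mj : j \in [:: i; j] by rewrite !inE eqxx orbT.
move=> P; rewrite !inE => /orP[/eqP->|].
  by exists one; rewrite pev_detX pad_diag // det1 oner_neq0.
move=> /orP[/eqP->|]; first by exists one; rewrite pev_adj_schurX c1 // eqxx oner_neq0.
move=> /orP[/eqP->|]; first by exists one; rewrite pev_adj_schurX c1 // eqxx oner_neq0.
move=> /orP[/eqP->|].
  by have [a] := e i j nij mi mj; exists a; rewrite pev_adj_schurX.
move=> /orP[/eqP->|/eqP->].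
  by have [a] := e j i nji mj mi; exists a; rewrite pev_adj_schurX.
exists one; rewrite pev_schur_minor !c1 // !eqxx (negPf nij) (negPf nji).
by rewrite mulr1 mulr0 subr0 oner_neq0.
Qed.

End Polynomials.

(** * The coordinate differentials as logarithmic forms *)
Section LogForms.
Variables (K : numFieldType) (n : nat).
Implicit Types (a b c u v w t : 'M[K]_n) (i j k l : 'I_n).

Definition dlog (f : 'M[K]_n -> K) a u : K := 'd (f : _ -> K^o) a u / f a.

Lemma dlogE f a L u : has_diff f a L -> dlog f a u = L u / f a.
Proof. by case=> _ H; rewrite /dlog H. Qed.

Lemma differentiable_pev P a : differentiable (pev P : 'M[K]_n -> K^o) a.
Proof.
have Hm m : differentiable (fun x : 'M[K]_n =>
    mpoly.mcoeff m P * \prod_i mx_coord x i ^+ mpoly.fun_of_multinom m i : K^o) a.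
  apply: (has_diffM (has_diff_cst (mpoly.mcoeff m P) a) (has_diff_ex _)).1.
  apply: differentiable_prod => i.
  have dc : differentiable (fun x : 'M[K]_n => mx_coord x i : K^o) a.
    rewrite /mx_coord; case/mxvec_indexP: i => i j.
    by under eq_fun do rewrite mxvecE; exact: differentiable_coord.
  elim: (mpoly.fun_of_multinom m i) => [|k IH].
    by under eq_fun do rewrite expr0; exact: (has_diff_cst 1 a).1.
  under eq_fun do rewrite exprS.
  exact: (has_diffM (has_diff_ex dc) (has_diff_ex IH)).1.
have S := has_diff_sum (mpoly.msupp P) (P := predT) (fun m _ => has_diff_ex (Hm m)).
by apply: (has_diff_eq _ (frefl _) S).1 => x; rewrite /pev mpoly.mevalE.
Qed.

Definition dp i j a u :=
  let I := itv i.+1 j in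
  dlog (pev (schur_minor K I i j)) a u - dlog (pev (adj_schurX K I i i)) a u
    - dlog (pev (adj_schurX K I j j)) a u.

Definition dq i j a u :=
  let I := itv i.+1 j in
  dlog (pev (adj_schurX K I i j)) a u - dlog (pev (adj_schurX K I j i)) a u.

Lemma dlog_linear f a (c : K) u v : dlog f a (c *: u + v) = c * dlog f a u + dlog f a v.
Proof. by rewrite /dlog linearP mulrDl mulrA. Qed.

Lemma dp_linear i j a (c : K) u v : dp i j a (c *: u + v) = c * dp i j a u + dp i j a v.
Proof.
rewrite /dp; move: (pev _) (pev _) (pev _) => f g h; rewrite !dlog_linear.
move: (dlog f a u) (dlog f a v) (dlog g a u) (dlog g a v) (dlog h a u) (dlog h a v).
by move=> *; ring.
Qed.

Lemma dq_linear i j a (c : K) u v : dq i j a (c *: u + v) = c * dq i j a u + dq i j a v.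
Proof.
rewrite /dq; move: (pev _) (pev _) => f g; rewrite !dlog_linear.
by move: (dlog f a u) (dlog f a v) (dlog g a u) (dlog g a v) => *; ring.
Qed.

(** The entries of [adj_schur] are those of [schur] times one common factor; its
    differential [D] cancels in [dp] and [dq]. *)
Lemma has_diff_adj_schur (I : pred 'I_n) a : pad I a \in unitmx ->
  exists D : 'M[K]_n -> K, forall k l, has_diff (pev (adj_schurX K I k l)) a
    (fun u => D u * schur I a k l + \det (pad I a) * dschur I a u k l).
Proof.
move=> uG.
have dd := has_diff_ex (differentiable_det (fun i j => (mx_diff_pad I a i j).1)).
exists ('d (fun x => \det (pad I x) : K^o) a) => k' l'.
apply: has_diff_near (has_diffM dd (mx_diff_schur uG k' l')).
apply: filterS (mx_diff_near_unit (mx_diff_pad I a) uG) => x ux.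
by rewrite pev_adj_schurX adj_schurE // mxZE.
Qed.

Lemma dp_dqE i j a u : regular i j a ->
  dp i j a u = p_form (itv i.+1 j) i j a u /\ dq i j a u = q_form (itv i.+1 j) i j a u.
Proof.
rewrite /dp /dq; set I : pred 'I_n := itv i.+1 j => -[uG [x0 t0] [y0 z0] D0].
have [D HD] := has_diff_adj_schur uG.
have E k l : pev (adj_schurX K I k l) a = \det (pad I a) * schur I a k l.
  by rewrite pev_adj_schurX adj_schurE // mxZE.
have d0 : \det (pad I a) != 0 by rewrite -unitfE -unitmxE.
have Hdet := has_diffB (has_diffM (HD i i) (HD j j)) (has_diffM (HD i j) (HD j i)).
have fE : (fun x => pev (adj_schurX K I i i) x * pev (adj_schurX K I j j) x
    - pev (adj_schurX K I i j) x * pev (adj_schurX K I j i) x) =1 pev (schur_minor K I i j).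
  by move=> x; rewrite pev_schur_minor !pev_adj_schurX.
have Hp := has_diff_eq fE (frefl _) Hdet.
rewrite (dlogE u Hp) !(dlogE u (HD _ _)) pev_schur_minor -!pev_adj_schurX !E /p_form /q_form.
move: (schur I a) (dschur I a u) x0 t0 y0 z0 D0 => S T x0 t0 y0 z0 D0.
move: (\det (pad I a)) (D u) d0 => d du d0.
move: x0 t0 y0 z0 D0; move: (S i i) (S j j) (S i j) (S j i) => x t y z x0 t0 y0 z0 D0.
have D1 : d * x * (d * t) - d * y * (d * z) != 0.
  by rewrite mulrACA [X in _ - X]mulrACA -mulrBr !mulf_neq0.
by split; field; rewrite ?x0 ?t0 ?y0 ?z0 ?D0 ?d0.
Qed.
End LogForms.

(** * Rank and independence *)
Section Rank.
Variables (K : numFieldType) (n : nat) (I : finType).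
Variables (x y : I -> 'M[K]_n -> K) (B : 'M[K]_n -> 'M[K]_n -> K).
Hypotheses (lx : forall i (c : K) u v, x i (c *: u + v) = c * x i u + x i v)
           (ly : forall i (c : K) u v, y i (c *: u + v) = c * y i u + y i v).
Hypothesis BE : forall u w, B u w = \sum_i wedge (x i) (y i) u w.
Hypothesis ind : independent x y.

Let e (k : 'I_(n * n)) : 'M[K]_n := vec_mx (delta_mx 0 k).
Let X : 'M[K]_(#|I|, n * n) := \matrix_(k, l) x (enum_val k) (e l).
Let Y : 'M[K]_(#|I|, n * n) := \matrix_(k, l) y (enum_val k) (e l).

Lemma linear_eq0 (f : 'M[K]_n -> K) :
  (forall (c : K) u v, f (c *: u + v) = c * f u + f v) ->
  (forall k, f (e k) = 0) -> forall u, f u = 0.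
Proof.
move=> lf fe u.
have f0 : f 0 = 0.
  by apply: (addrI (f 0)); have := lf 1 0 0; rewrite scale1r !addr0 mul1r.
have fD v w : f (v + w) = f v + f w by have := lf 1 v w; rewrite scale1r mul1r.
have fZ c v : f (c *: v) = c * f v by have := lf c v 0; rewrite !addr0 f0 addr0.
rewrite -(mxvecK u) [mxvec u]row_sum_delta linear_sum /=.
rewrite (big_morph f fD f0) big1 // => k _.
by rewrite linearZ /= fZ fe mulr0.
Qed.

(** In coordinates the 2-form is [X^T Y - Y^T X], the product of the transpose
    of [(X, Y)] and of [(Y, - X)]; both are row free by independence. *)
Lemma rank_canonical : \rank (two_form_mx B) = (#|I| + #|I|)%N.
Proof.
have free (X1 X2 : 'M[K]_(#|I|, n * n)) (f g : I -> 'M[K]_n -> K) :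
    (forall i (c : K) u v, f i (c *: u + v) = c * f i u + f i v) ->
    (forall i (c : K) u v, g i (c *: u + v) = c * g i u + g i v) ->
    independent f g ->
    (forall k l, X1 k l = f (enum_val k) (e l)) ->
    (forall k l, X2 k l = g (enum_val k) (e l)) -> row_free (col_mx X1 X2).
  move=> lf lg fg X1E X2E; apply: inj_row_free => v.
  rewrite -(hsubmxK v) mul_row_col => /rowP v0.
  have H u : \sum_i (lsubmx v 0 (enum_rank i) * f i u + rsubmx v 0 (enum_rank i) * g i u) = 0.
    apply: (@linear_eq0 (fun u => _)) u => [c u w|k].
      rewrite mulr_sumr -big_split; apply: eq_bigr => i _; rewrite lf lg /=; ring.
    rewrite (reindex (@enum_val I predT)) /=; last exact: (onW_bij _ (enum_val_bij I)).
    have := v0 k; rewrite !mxE -big_split /= => E; rewrite -[RHS]E; apply: eq_bigr => i _.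
    by rewrite !enum_valK X1E X2E.
  have Hst := fg _ _ H.
  have l0 : lsubmx v = 0.
    by apply/rowP=> k; have [+ _] := Hst (enum_val k); rewrite enum_valK => ->; rewrite mxE.
  have r0 : rsubmx v = 0.
    by apply/rowP=> k; have [_] := Hst (enum_val k); rewrite enum_valK => ->; rewrite mxE.
  by rewrite l0 r0 row_mx0.
have -> : two_form_mx B = (col_mx X Y)^T *m col_mx Y (- X).
  rewrite tr_col_mx mul_row_col; apply/matrixP=> k l.
  rewrite mxE BE mxDE mulmxN mxNE [X in X - _]mxE [X in _ - X]mxE -sumrB.
  rewrite (reindex (@enum_val I predT)) /=; last exact: (onW_bij _ (enum_val_bij I)).
  by apply: eq_bigr => i _; rewrite !mxE /wedge [X in _ - X]mulrC.
rewrite mxrankMfree; last first.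
  apply: (@free _ _ y (fun i u => - x i u)) => //.
  - by move=> i c u v; rewrite lx; ring.
  - move=> s t st i.
    have /ind/(_ i)[/eqP + ->] : forall u, \sum_i (- t i * x i u + s i * y i u) = 0.
      move=> u; rewrite -[RHS](st u); apply: eq_bigr => j _; ring.
    by rewrite oppr_eq0 => /eqP.
  - by move=> k l; rewrite mxE.
  - by move=> k l; rewrite !mxE.
by rewrite mxrank_tr; apply/eqP; apply: (@free _ _ x y) => // k l; rewrite mxE.
Qed.
End Rank.

Section Independence.
Variables (K : numFieldType) (n : nat).
Implicit Types (a u v w : 'M[K]_n) (i j k l : 'I_n).

Lemma dschur_delta (I : pred 'I_n) a p q k l :
  dschur I a (delta_mx p q) k l = elim_l I a k p * elim_r I a q l.
Proof.
rewrite dschurE mxE (bigD1 q) //= big1 ?addr0 => [|m mq].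
  rewrite mxE (bigD1 p) //= big1 ?addr0 => [|m mp].
    by rewrite mxE !eqxx mulr1.
  by rewrite mxE (negPf mp) mulr0.
by rewrite mxE big1 ?mul0r // => m' _; rewrite mxE (negPf mq) andbF mulr0.
Qed.

Lemma elim_l_out (I : pred 'I_n) a p k : pad I a \in unitmx -> ~~ I p ->
  elim_l I a k p = (k == p)%:R.
Proof.
move=> uG Ip; have [_ Ne _ _] := padinvP uG.
by rewrite elim_lE mxBE -Ne mulmxA mul_projE (negPf Ip) mulr0 subr0 mxE.
Qed.

Lemma elim_r_out (I : pred 'I_n) a q l : pad I a \in unitmx -> ~~ I q ->
  elim_r I a q l = (q == l)%:R.
Proof.
move=> uG Iq; have [eN _ _ _] := padinvP uG.
by rewrite elim_rE mxBE -eN -mulmxA proj_mulE (negPf Iq) mul0r subr0 mxE.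
Qed.

(** [elim_l] differs from the identity only in the columns in [I], so an
    entry of [a] whose row or column is not between [i] and [j] does not affect
    the Schur complement at [i], [j]. *)
Lemma dschur_far i j a (p q : 'I_n) k l : (i < j)%N -> pad (itv i.+1 j) a \in unitmx ->
    ~~ (i <= p <= j)%N || ~~ (i <= q <= j)%N ->
    k \in [:: i; j] -> l \in [:: i; j] ->
  dschur (itv i.+1 j) a (delta_mx p q) k l = 0.
Proof.
move=> ij uG pq kij lij; rewrite dschur_delta; case/orP: pq => pq.
  rewrite elim_l_out //; last by rewrite /itv; lia.
  rewrite [k == p](_ : _ = false) ?mul0r //; apply: contraNF pq => /eqP<-.
  by move: kij; rewrite !inE => /orP[]/eqP->; lia.
rewrite elim_r_out //; last by rewrite /itv; lia.
rewrite [q == l](_ : _ = false) ?mulr0 //; apply: contraNF pq => /eqP->.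
by move: lij; rewrite !inE => /orP[]/eqP->; lia.
Qed.

Lemma forms_far i j a (p q : 'I_n) : (i < j)%N -> pad (itv i.+1 j) a \in unitmx ->
    ~~ (i <= p <= j)%N || ~~ (i <= q <= j)%N ->
  p_form (itv i.+1 j) i j a (delta_mx p q) = 0 /\
  q_form (itv i.+1 j) i j a (delta_mx p q) = 0.
Proof.
move=> ij uG pq; have ii : i \in [:: i; j] by rewrite inE eqxx.
have jj : j \in [:: i; j] by rewrite !inE eqxx orbT.
by rewrite /p_form /q_form !(dschur_far ij uG pq) // !(mul0r, mulr0, addr0, subr0).
Qed.

Lemma dschur_near i j a (p q : 'I_n) k l : pad (itv i.+1 j) a \in unitmx ->
    p \in [:: i; j] -> q \in [:: i; j] ->
  dschur (itv i.+1 j) a (delta_mx p q) k l = ((k == p) && (q == l))%:R.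
Proof.
have out r : r \in [:: i; j] -> ~~ itv i.+1 j r.
  by rewrite !inE /itv => /orP[]/eqP->; rewrite ltnn ?andbF.
by move=> uG /out Ip /out Iq; rewrite dschur_delta elim_l_out // elim_r_out // -natrM mulnb.
Qed.

(** On [E_ij] and [E_ji] only [y], resp. [z], varies, at rate one.  Hence
    [p_form] takes the values [- z / (x u - y z)] and [- y / (x u - y z)], and
    [q_form] the values [1 / y] and [- 1 / z], a system with determinant
    [2 / (x u - y z)]. *)
Lemma forms_near i j a (s t : K) : (i < j)%N -> regular i j a ->
    let I := itv i.+1 j in
    s * p_form I i j a (delta_mx i j) + t * q_form I i j a (delta_mx i j) = 0 ->
    s * p_form I i j a (delta_mx j i) + t * q_form I i j a (delta_mx j i) = 0 ->
  s = 0 /\ t = 0.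
Proof.
move=> ij [uG [x0 u0] [y0 z0] D0] /=.
have nij : i != j by rewrite neq_ltn ij.
have nji : j != i by rewrite eq_sym.
have ii : i \in [:: i; j] by rewrite inE eqxx.
have jj : j \in [:: i; j] by rewrite !inE eqxx orbT.
rewrite /p_form /q_form /= !dschur_near // !eqxx !(negPf nij) !(negPf nji) /=.
move: (schur _ a) x0 u0 y0 z0 D0 => S x0 u0 y0 z0 D0.
move: x0 u0 y0 z0 D0; move: (S i i) (S j j) (S i j) (S j i) => x u y z x0 u0 y0 z0 D0 H1 H2.
have E1 : t = s * (y * z) / (x * u - y * z).
  rewrite -[LHS](addr0) -[X in _ + X](mulr0 (- y)) -H1; field.
  by rewrite ?x0 ?u0 ?y0 ?z0 ?D0.
have E2 : t = - (s * (y * z) / (x * u - y * z)).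
  rewrite -[LHS](addr0) -[X in _ + X](mulr0 z) -H2; field.
  by rewrite ?x0 ?u0 ?y0 ?z0 ?D0.
have t0 : t = 0.
  have /eqP : t *+ 2 = 0 by rewrite mulr2n {1}E1 E2 subrr.
  by rewrite mulrn_eq0 => /eqP.
split=> //; move/eqP: E1; rewrite t0 eq_sym !mulf_eq0 invr_eq0 (negPf D0) (negPf y0) (negPf z0).
by rewrite !orbF => /eqP.
Qed.

(** Downward induction on the gap [j - i].  Against [E_ij] and [E_ji], the pairs
    with a wider gap have zero coefficients by induction, and the other pairs,
    whose interval does not contain both [i] and [j], have zero forms by
    [forms_far]. *)
Lemma forms_independent (I : finType) (e : I -> 'I_n * 'I_n) a :
    injective e -> (forall p, ((e p).1 < (e p).2)%N) ->
    (forall p, regular (e p).1 (e p).2 a) ->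
  independent (fun p => p_form (itv (e p).1.+1 (e p).2) (e p).1 (e p).2 a)
              (fun p => q_form (itv (e p).1.+1 (e p).2) (e p).1 (e p).2 a).
Proof.
move=> inje elt ereg s t H.
pose gap p := ((e p).2 - (e p).1)%N.
suff IH m p : (n - gap p <= m)%N -> s p = 0 /\ t p = 0 by move=> p; apply: IH (leqnn _).
elim: m p => [|m IH] p mp.
  have := ltn_ord (e p).2; move: mp (elt p); rewrite /gap; lia.
have zero q (u : 'M[K]_n) : q != p ->
    u = delta_mx (e p).1 (e p).2 \/ u = delta_mx (e p).2 (e p).1 ->
    s q * p_form (itv (e q).1.+1 (e q).2) (e q).1 (e q).2 a u +
    t q * q_form (itv (e q).1.+1 (e q).2) (e q).1 (e q).2 a u = 0.
  move=> qp uE; have [gq|gq] := ltnP (gap p) (gap q).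
    have [-> ->] : s q = 0 /\ t q = 0; last by rewrite !mul0r addr0.
    by apply: IH; move: mp gq (ltn_ord (e q).2) (elt q); rewrite /gap; lia.
  have nepq : (e q).1 != (e p).1 \/ (e q).2 != (e p).2.
    apply/orP; rewrite -negb_and -xpair_eqE -!surjective_pairing.
    by rewrite (inj_eq inje).
  have [uG _ _ _] := ereg q.
  have far : (~~ ((e q).1 <= (e p).1 <= (e q).2) || ~~ ((e q).1 <= (e p).2 <= (e q).2))%N.
    by move: nepq gq (elt q) (elt p); rewrite /gap -!val_eqE /=; lia.
  case: uE => ->.
    by have [-> ->] := forms_far (elt q) uG far; rewrite !mulr0 addr0.
  rewrite orbC in far.
  by have [-> ->] := forms_far (elt q) uG far; rewrite !mulr0 addr0.
have Hp u : u = delta_mx (e p).1 (e p).2 \/ u = delta_mx (e p).2 (e p).1 ->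
    s p * p_form (itv (e p).1.+1 (e p).2) (e p).1 (e p).2 a u +
    t p * q_form (itv (e p).1.+1 (e p).2) (e p).1 (e p).2 a u = 0.
  move=> uE; rewrite -[RHS](H u) (bigD1 p) //= big1 ?addr0 // => q qp.
  exact: zero qp uE.
by apply: (forms_near (elt p) (ereg p)); apply: Hp; [left|right].
Qed.
End Independence.

(** * The dense open set *)
Section Dense.
Variables (K : numFieldType) (n : nat).
Implicit Types (a b u v w : 'M[K]_n).
Local Notation MP := (mpoly.mpoly (n * n) K).

Definition line_poly (P : MP) a b : {poly K} :=
  mpoly.mmap polyC (fun k => (mx_coord a k)%:P + 'X * (mx_coord (b - a) k)%:P) P.

Lemma mx_coord_line a b (t : K) k :
  mx_coord (a + t *: (b - a)) k = mx_coord a k + t * mx_coord (b - a) k.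
Proof. by rewrite /mx_coord linearD linearZ /= !mxE. Qed.

Lemma line_polyE (P : MP) a b t : (line_poly P a b).[t] = pev P (a + t *: (b - a)).
Proof.
rewrite /line_poly /mpoly.mmap /pev mpoly.mevalE horner_sum; apply: eq_bigr => m _.
rewrite hornerM hornerC /mpoly.mmap1 horner_prod; congr (_ * _); apply: eq_bigr => k _.
by rewrite horner_exp mx_coord_line !hornerE mulrC.
Qed.

Lemma poly_nonroot_near0 (q : {poly K}) (d : K) : q != 0 -> 0 < d ->
  exists2 t, `|t| < d & q.[t] != 0.
Proof.
move=> q0 d0; apply: contrapT => H.
pose ts := [seq d / (k.+2)%:R | k <- iota 0 (size q)].
have tsP t : t \in ts -> `|t| < d.
  case/mapP=> k _ ->; rewrite ger0_norm ?divr_ge0 ?ltW ?ltr0n //.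
  by rewrite ltr_pdivrMr ?ltr0n // ltr_pMr // ltr1n.
have rts : all (root q) ts.
  apply/allP => t /tsP td; apply/negPn/negP => qt; by apply: H; exists t.
have uts : uniq ts.
  rewrite map_inj_uniq ?iota_uniq // => k l /(mulfI (lt0r_neq0 d0)) /invr_inj /eqP.
  by rewrite eqr_nat => /eqP[].
by have := max_poly_roots q0 rts uts; rewrite size_map size_iota ltnn.
Qed.

(** On the line from [a] to [b] the polynomial restricts to a nonzero polynomial
    in one variable, which has finitely many roots. *)
Lemma pev_dense (P : MP) (W : set 'M[K]_n) a b : open W -> W a -> pev P b != 0 ->
  exists2 x, W x & pev P x != 0.
Proof.
move=> oW Wa Pb.
have q0 : line_poly P a b != 0.
  apply: contra_neq Pb => q0.
  by rewrite -[b](subrKC a) -[X in a + X]scale1r -line_polyE q0 horner0.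
have /nbhs_ballP[e /= e0 We] := open_nbhs_nbhs (conj oW Wa).
have n0 : 0 < `|b - a| + 1 by rewrite ltr_wpDl.
have [t td qt] := poly_nonroot_near0 q0 (divr_gt0 e0 n0).
exists (a + t *: (b - a)); last by rewrite -line_polyE.
apply: We; rewrite -ball_normE /= opprD addNKr normrN normrZ.
rewrite (@le_lt_trans _ _ (`|t| * (`|b - a| + 1))) //; last by rewrite -ltr_pdivlMr.
by rewrite ler_wpM2l // lerDl.
Qed.

Lemma pev_dense_seq (s : seq MP) (W : set 'M[K]_n) a : open W -> W a ->
  (forall P, P \in s -> exists b, pev P b != 0) ->
  exists2 x, W x & forall P, P \in s -> pev P x != 0.
Proof.
elim: s W a => [|P s IH] W a oW Wa H; first by exists a.
have [b Pb] := H P (mem_head _ _).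
have [x Wx Px] := pev_dense oW Wa Pb.
pose W' := W `&` [set x | pev P x != 0].
have oW' : open W'.
  apply: openI => //; rewrite openE => y /= Py.
  exact: differentiable_near_neq0 (differentiable_pev P y) Py.
have [|z [Wz Pz] Hz] := IH W' x oW' (conj Wx Px).
  by move=> Q Qs; apply: H; rewrite inE Qs orbT.
exists z => // Q; rewrite inE => /orP[/eqP->//|]; exact: Hz.
Qed.

Definition all_minors : seq MP :=
  flatten [seq minors K p.1 p.2 | p <- enum [pred p : 'I_n * 'I_n | (p.1 < p.2)%N]].

(** A single polynomial suffices: the product of all the minors. *)
Definition generic_set : set 'M[K]_n :=
  GLstar `&` [set a | exists2 P, P \in [:: \prod_(P <- all_minors) P] &
                        mpoly.meval (mx_coord a) P != 0].

Lemma generic_setP a : generic_set a <-> GLstar a /\ forall P, P \in all_minors -> pev P a != 0.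
Proof.
have E : pev (\prod_(P <- all_minors) P) a = \prod_(P <- all_minors) pev P a.
  exact: (big_morph _ (mpoly.mevalM _) (mpoly.meval1 _)).
split=> [[sa [P]]|[sa H]].
  rewrite inE => /eqP-> Pa; split=> // Q Qs.
  by move: Pa; rewrite -/(pev _ _) E prodf_seq_neq0 => /allP /(_ _ Qs).
split=> //; exists (\prod_(P <- all_minors) P); rewrite ?inE // -/(pev _ _) E.
by rewrite prodf_seq_neq0; apply/allP => P /H.
Qed.

Lemma dense_open_generic_set : dense_open_algebraic generic_set.
Proof.
have oS : open (GLstar : set 'M[K]_n).
  by rewrite openE => a /= sa; exact: GLstar_near sa.
split; first by exists [:: \prod_(P <- all_minors) P].
  apply: openI => //; rewrite openE => a /= [P Ps Pa].
  have := differentiable_near_neq0 (differentiable_pev P a) Pa.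
  by apply: filterS => x Px; exists P.
move=> a sa W /nbhs_interior Wa.
have oW : open (W^° `&` GLstar) by apply: openI => //; exact: open_interior.
have [|x [Wx sx] Hx] := pev_dense_seq (s := all_minors) oW (conj (nbhs_singleton Wa) sa).
  move=> P /flatten_mapP[[i j]]; rewrite mem_enum /= => ij.
  exact: minors_nonzero ij P.
by exists x; split; [apply/generic_setP|exact: interior_subset Wx].
Qed.

Lemma generic_set_regular a (i j : 'I_n) : generic_set a -> (i < j)%N -> regular i j a.
Proof.
move=> /generic_setP[_ H] ij; apply: regularP => P Pm; apply: H.
by apply/flatten_mapP; exists (i, j); rewrite ?mem_enum.
Qed.

Lemma card_pairs : #|[pred p : 'I_n * 'I_n | (p.1 < p.2)%N]| = ((n ^ 2 - n)./2)%N.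
Proof.
rewrite -sum1_card -(pair_big_dep predT (fun i j : 'I_n => (i < j)%N) (fun i j : 'I_n => 1%N)) /=.
rewrite (exchange_big_dep predT) //=.
transitivity (\sum_(j < n) j)%N.
  apply: eq_bigr => j _; rewrite -(big_ord_widen n (fun=> 1%N) (ltnW (ltn_ord j))).
  by rewrite sum1_card card_ord.
rewrite -(big_mkord predT id) bin2_sum bin2 -mulnn.
by congr (_./2); case: n => // m; rewrite /= [in RHS]mulSn addKn mulnC.
Qed.
End Dense.

(** * A weighted norm on polynomials *)
Lemma eq_sum_support (V : nmodType) (T : eqType) (s1 s2 : seq T) (F : T -> V) :
  uniq s1 -> uniq s2 -> (forall m, F m != 0 -> (m \in s1) = (m \in s2)) ->
  \sum_(m <- s1) F m = \sum_(m <- s2) F m.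
Proof.
move=> u1 u2 H.
have E s : \sum_(m <- s) F m = \sum_(m <- [seq m <- s | F m != 0]) F m.
  rewrite big_filter [LHS](bigID (fun m => F m != 0)) /= [X in _ + X]big1 ?addr0 // => m.
  by rewrite negbK => /eqP.
rewrite (E s1) (E s2); apply: perm_big; apply: uniq_perm; rewrite ?filter_uniq // => m.
by rewrite !mem_filter; case: (boolP (F m != 0)) => //= /H.
Qed.

Section PolyNorm.
Variables (K : numFieldType) (N : nat).
Local Notation MP := (mpoly.mpoly N K).
Local Notation mm := (mpoly.multinom N).
Local Notation coef m R := (mpoly.mcoeff m R).
Local Notation supp := mpoly.msupp.
Local Notation deg := mpoly.mdeg.
Implicit Types (R S : MP) (m : mm) (h : 'I_N -> K) (rho : K).

Definition mon_eval m h : K := \prod_i h i ^+ mpoly.fun_of_multinom m i.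

(** It bounds the values on the polydisc of radius [rho] together with all sums
    of absolute values of monomials there. *)
Definition mnorm rho R : K := \sum_(m <- supp R) `|coef m R| * rho ^+ deg m.

Lemma mnorm_ge0 rho R : 0 <= rho -> 0 <= mnorm rho R.
Proof. by move=> r0; apply: sumr_ge0 => m _; rewrite mulr_ge0 ?exprn_ge0. Qed.

Lemma mnormE rho R (s : seq mm) : uniq s -> {subset supp R <= s} ->
  mnorm rho R = \sum_(m <- s) `|coef m R| * rho ^+ deg m.
Proof.
move=> us sub; apply: eq_sum_support => //.
move=> m; rewrite mulf_eq0 negb_or normr_eq0 -mpoly.mcoeff_msupp => /andP[mR _].
by rewrite mR sub.
Qed.

Lemma mnormD rho R S : 0 <= rho -> mnorm rho (R + S) <= mnorm rho R + mnorm rho S.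
Proof.
move=> r0; pose s := undup (supp (R + S) ++ supp R ++ supp S).
have us : uniq s by exact: undup_uniq.
rewrite !(@mnormE _ _ s) //; try by move=> m mR; rewrite mem_undup !mem_cat mR ?orbT.
rewrite -big_split; apply: ler_sum => m _ /=.
by rewrite -mulrDl ler_wpM2r ?exprn_ge0 // mpoly.mcoeffD ler_normD.
Qed.

Lemma mnorm0 rho : mnorm rho 0 = 0.
Proof. by rewrite /mnorm mpoly.msupp0 big_nil. Qed.

Lemma mnorm_sum rho (T : Type) (r : seq T) (F : T -> MP) : 0 <= rho ->
  mnorm rho (\sum_(i <- r) F i) <= \sum_(i <- r) mnorm rho (F i).
Proof.
move=> r0; elim: r => [|i r IH]; first by rewrite !big_nil mnorm0.
by rewrite !big_cons (le_trans (mnormD _ _ r0)) // lerD2l.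
Qed.

Lemma mnormZX rho (c : K) m : 
  mnorm rho (c *: mpoly.mpolyX K m) = `|c| * rho ^+ deg m.
Proof.
rewrite (@mnormE _ _ [:: m]) //.
  by rewrite big_seq1 mpoly.mcoeffZ mpoly.mcoeffX eqxx mulr1.
move=> k; rewrite mpoly.mcoeff_msupp mpoly.mcoeffZ mpoly.mcoeffX inE (eq_sym k).
by case: (m == k) => //=; rewrite mulr0 eqxx.
Qed.

Lemma mnormM rho R S : 0 <= rho -> mnorm rho (R * S) <= mnorm rho R * mnorm rho S.
Proof.
move=> r0; rewrite [X in X * _](mpoly.mpolyE R) [X in _ * X](mpoly.mpolyE S).
rewrite mulr_suml (le_trans (mnorm_sum _ _ r0)) // [X in _ <= X]mulr_suml.
apply: ler_sum => m _; rewrite mulr_sumr (le_trans (mnorm_sum _ _ r0)) // mulr_sumr.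
apply: ler_sum => k _.
rewrite -scalerAl -scalerAr scalerA -mpoly.mpolyXD mnormZX mpoly.mdegD normrM exprD.
by rewrite mulrACA.
Qed.

Lemma mnormX rho R k : 0 <= rho -> mnorm rho (R ^+ k) <= mnorm rho R ^+ k.
Proof.
move=> r0; elim: k => [|k IH].
  rewrite !expr0 (@mnormE _ _ [:: mpoly.mnm0]) //.
    by rewrite big_seq1 mpoly.mcoeff1 eqxx normr1 mul1r mpoly.mdeg0 expr0.
  move=> m; rewrite mpoly.mcoeff_msupp mpoly.mcoeff1 inE.
  by case: (m == _) => //=; rewrite eqxx.
by rewrite !exprS (le_trans (mnormM _ _ r0)) // ler_wpM2l ?mnorm_ge0.
Qed.

(** Every monomial of [R] has positive degree, so [rho^|m|] is at most [rho]. *)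
Lemma mnorm_scale rho R : 0 <= rho <= 1 -> coef mpoly.mnm0 R = 0 ->
  mnorm rho R <= rho * mnorm 1 R.
Proof.
case/andP=> r0 r1 R0; rewrite mulr_sumr [leLHS]big_seq [leRHS]big_seq.
apply: ler_sum => m mR; rewrite mulrCA ler_wpM2l // expr1n mulr1.
have : deg m != 0%N.
  by rewrite mpoly.mdeg_eq0; apply: contraTneq mR => ->; rewrite mpoly.mcoeff_msupp R0 eqxx.
case: (deg m) => // d _; rewrite exprS -[X in _ <= X]mulr1 ler_wpM2l //.
by rewrite exprn_ile1.
Qed.

Lemma mon_eval_le rho m h : (forall i, `|h i| <= rho) -> `|mon_eval m h| <= rho ^+ deg m.
Proof.
move=> hr; rewrite normr_prod mpoly.mdegE -prodrXr; apply: ler_prod => i _.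
by rewrite normr_ge0 normrX lerXn2r ?nnegrE // (le_trans _ (hr i)).
Qed.

(** Indexed by all exponents of degree less than [d] as in a power series, rather
    than by the support of [R]. *)
Definition truncation d R h : K := \sum_(m : mpoly.bmultinom N d) coef m R * mon_eval m h.

Lemma sum_bmultinom (V : nmodType) d (F : mm -> V) (s : seq mm) : uniq s ->
  (forall m, F m != 0 -> (deg m < d)%N -> m \in s) ->
  \sum_(m : mpoly.bmultinom N d) F m = \sum_(m <- s | (deg m < d)%N) F m.
Proof.
move=> us H; rewrite -(big_map (@mpoly.bmnm N d) predT F) -[RHS]big_filter.
apply: eq_sum_support; rewrite ?filter_uniq //.
  by rewrite map_inj_uniq ?index_enum_uniq //; exact: val_inj.
move=> m Fm; rewrite mem_filter; apply/mapP/andP => [[k _ E]|[md ms]].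
  by rewrite E in Fm *; split; [exact: mpoly.bmdeg|exact: H (mpoly.bmdeg k)].
exists (mpoly.BMultinom md) => //; exact: mem_index_enum.
Qed.

Lemma pevE R h : mpoly.meval h R = \sum_(m <- supp R) coef m R * mon_eval m h.
Proof. exact: mpoly.mevalE. Qed.

Lemma truncationE d R h : truncation d R h = \sum_(m <- supp R | (deg m < d)%N) coef m R * mon_eval m h.
Proof.
apply: (sum_bmultinom (F := fun m => coef m R * mon_eval m h)); first exact: mpoly.msupp_uniq.
by move=> m; rewrite mulf_eq0 negb_or -mpoly.mcoeff_msupp => /andP[].
Qed.

Lemma truncation_abs rho d R h : (forall i, `|h i| <= rho) -> 0 <= rho ->
  \sum_(m : mpoly.bmultinom N d) `|coef m R * mon_eval m h| <= mnorm rho R.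
Proof.
move=> hr r0; rewrite (sum_bmultinom (F := fun m => `|coef m R * mon_eval m h|) (s := supp R)).
- rewrite /mnorm [leRHS](bigID (fun m => (deg m < d)%N)) /= -[leLHS]addr0 lerD //.
    by apply: ler_sum => m _; rewrite normrM ler_wpM2l // mon_eval_le.
  by apply: sumr_ge0 => m _; rewrite mulr_ge0 ?exprn_ge0.
- exact: mpoly.msupp_uniq.
- by move=> m; rewrite normr_eq0 mulf_eq0 negb_or -mpoly.mcoeff_msupp => /andP[].
Qed.

Lemma meval_le rho R h : (forall i, `|h i| <= rho) -> 0 <= rho ->
  `|mpoly.meval h R| <= mnorm rho R.
Proof.
move=> hr r0; rewrite pevE (le_trans (ler_norm_sum _ _ _)) //.
by apply: ler_sum => m _; rewrite normrM ler_wpM2l // mon_eval_le.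
Qed.

(** A monomial of degree at least [d] gains a factor [2 ^ d] when the radius is
    doubled. *)
Lemma tail_le rho d R h : (forall i, `|h i| <= rho) -> 0 <= rho ->
  `|mpoly.meval h R - truncation d R h| <= 2 ^- d * mnorm (2 * rho) R.
Proof.
move=> hr r0; rewrite pevE truncationE (bigID (fun m => (deg m < d)%N)) /= addrC addrK.
rewrite (le_trans (ler_norm_sum _ _ _)) // /mnorm.
rewrite mulr_sumr [leRHS](bigID (fun m => (deg m < d)%N)) /= -[leLHS]add0r lerD //.
  by apply: sumr_ge0 => m _; rewrite !mulr_ge0 ?exprn_ge0 ?invr_ge0 ?exprn_ge0 ?mulr_ge0.
apply: ler_sum => m; rewrite -leqNgt => dm; rewrite normrM mulrCA ler_wpM2l //.
rewrite (le_trans (mon_eval_le _ hr)) // exprMn mulrA ler_peMl ?exprn_ge0 //.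
rewrite -(subnK dm) exprD [X in _ * X]mulrC mulKf ?expf_neq0 ?pnatr_eq0 //.
by rewrite exprn_ege1 // ler1n.
Qed.

End PolyNorm.

(** * Branches of the logarithm *)
Section LogSeries.
Variable (K : numFieldType).

Definition log_coef k : K := (-1) ^+ k / k.+1%:R.

Lemma log_coef_le1 k : `|log_coef k| <= 1.
Proof.
rewrite normrM normrX normrN1 expr1n mul1r normfV ger0_norm ?ler0n //.
by rewrite invf_le1 ?ltr0n // ler1n.
Qed.

Definition logsum (w : K) d : K := \sum_(k < d) log_coef k * w ^+ k.+1.

(** [log (z + h) - log z = log (1 + h / z)], expanded in a power series.  Over an
    arbitrary field this property is all that is used of a logarithm: it gives
    the derivative and analyticity of compositions. *)
Definition log_branch (L : K -> K) (D : set K) := forall z, D z -> z != 0 /\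
  exists2 e : K, 0 < e & forall h, `|h| < e ->
    (fun d => logsum (h / z) d : K^o) @ \oo --> (L (z + h) - L z : K^o).

Definition archimedean := forall e : K, 0 < e -> exists d, 2 ^- d <= e.

Lemma geom_le1 (x : K) d : 0 <= x -> x <= 2^-1 -> \sum_(k < d) x ^+ k.+1 <= 1.
Proof.
move=> x0 x2; suff H : \sum_(k < d) x ^+ k.+1 <= 1 - 2 ^- d.
  by rewrite (le_trans H) // gerBl invr_ge0 exprn_ge0.
elim: d => [|d IH]; first by rewrite big_ord0 expr0 invr1 subrr.
rewrite big_ord_recr /=.
have : x ^+ d.+1 <= 2 ^- d.+1 by rewrite -exprVn lerXn2r // nnegrE invr_ge0.
move=> H; apply: le_trans (lerD IH H) _.
rewrite (_ : 2 ^- d = 2 ^- d.+1 + 2 ^- d.+1 :> K); last first.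
  by rewrite [LHS]splitr exprSr invfM.
by rewrite opprD addrA subrK.
Qed.

Lemma geom_le2 (x : K) d : 0 <= x -> x <= 2^-1 -> \sum_(k < d) x ^+ k <= 2.
Proof.
move=> x0 x2; rewrite (@le_trans _ _ (\sum_(k < d) 2 * 2^-1 ^+ k.+1)) //.
  by apply: ler_sum => k _; rewrite exprS mulVKf ?pnatr_eq0 // lerXn2r // nnegrE invr_ge0.
by rewrite -mulr_sumr -[leRHS]mulr1 ler_wpM2l // geom_le1 // invr_ge0.
Qed.

Lemma near_pow2 (B e : K) : archimedean -> 0 <= B -> 0 < e ->
  \forall d \near \oo, 2 ^- d * B <= e.
Proof.
move=> arch B0 e0.
have B1 : 0 < B + 1 by rewrite ltr_wpDl.
have [d0 Hd0] := arch _ (divr_gt0 e0 B1).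
exists d0 => // d /= dd0.
apply: (@le_trans _ _ (2 ^- d0 * (B + 1))); last by rewrite -ler_pdivlMr.
apply: ler_pM; rewrite ?invr_ge0 ?exprn_ge0 ?lerDl //.
by rewrite lef_pV2 ?posrE ?exprn_gt0 // ler_weXn2l // ler1n.
Qed.

(** The remainder of the series after its linear term is at most
    [2 |h / z| ^ 2] once [|h / z|] is at most one half. *)
Lemma log_branch_diff (L : K -> K) (D : set K) z : log_branch L D -> D z ->
  has_diff (L : K^o -> K) z (fun h : K^o => h / z).
Proof.
move=> LB Dz; have [z0 [e e0 H]] := LB z Dz.
have lin : linear (fun h : K^o => h / z : K^o).
  by move=> c u v; rewrite mulrDl -scalerAl.
pose cL : {linear K^o -> K^o} := HB.pack (fun h : K^o => h / z : K^o)
  (GRing.isLinear.Build _ _ _ _ _ lin).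
have cc : continuous cL by exact: mulrr_continuous.
have eL : (L : K^o -> K^o) \o shift (z : K^o) = cst (L z : K^o) + cL +o_ 0 id.
  apply/eqaddoP => c c0.
  have n0 : 0 < `|z| by rewrite normr_gt0.
  (* an inverse of a sum is smaller than each of the inverses: this replaces a
     minimum, since the order of the field need not be total *)
  pose de := (e^-1 + 2 / `|z| + 2 * `|z| ^- 2 / c)^-1.
  have p1 : 0 < e^-1 by rewrite invr_gt0.
  have p2 : 0 < 2 / `|z| by rewrite divr_gt0.
  have p3 : 0 < 2 * `|z| ^- 2 / c by rewrite divr_gt0 // mulr_gt0 // invr_gt0 exprn_gt0.
  have de0 : 0 < de by rewrite invr_gt0 !addr_gt0.
  apply/nbhs_ballP; exists de => // h; rewrite -ball_normE /= sub0r normrN => hde.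
  rewrite -[((L : K^o -> K^o) \o _ - _) h]/((L (h + z) : K^o) - (L z + h / z)).
  rewrite [h + z]addrC opprD addrA.
  have le_de (x y : K) : 0 < x -> 0 <= y -> de = (x + y)^-1 -> `|h| * x < 1.
    move=> x0 y0 deE; rewrite -ltr_pdivlMr // div1r (lt_le_trans hde) // deE.
    by rewrite lef_pV2 ?posrE // ?lerDl // ltr_wpDr.
  have h1 : `|h| < e.
    rewrite -[ltRHS]mul1r -ltr_pdivrMr //.
    by apply: (le_de _ (2 / `|z| + 2 * `|z| ^- 2 / c)); rewrite ?addr_ge0 ?ltW // /de addrA.
  have h2 : `|h / z| <= 2^-1.
    rewrite normf_div ltW // -[ltRHS]mul1r -ltr_pdivrMr ?invr_gt0 // invrK -mulrA [_ * 2]mulrC.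
    by apply: (le_de _ (e^-1 + 2 * `|z| ^- 2 / c)); rewrite ?addr_ge0 ?ltW // /de addrCA addrA.
  have h3 : 2 * `|h / z| ^+ 2 <= c * `|h|.
    have : `|h| * (2 * `|z| ^- 2 / c) < 1.
      by apply: (le_de _ (e^-1 + 2 / `|z|)); rewrite ?addr_ge0 ?ltW // /de addrC.
    rewrite mulrA ltr_pdivrMr // mul1r => /ltW H3.
    rewrite normf_div expr_div_n.
    rewrite (_ : 2 * (`|h| ^+ 2 / `|z| ^+ 2) = `|h| * (2 * `|z| ^- 2) * `|h|); last by ring.
    by rewrite ler_wpM2r.
  apply: le_trans h3; apply/ler_addgt0Pr => eps eps0.
  have /cvgrPdist_le /(_ _ eps0) [d0 _ Hd] := H h h1.
  have := Hd d0.+1 (leqnSn d0) => /= Hd1.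
  rewrite -[X in `|X|](subrKA (logsum (h / z) d0.+1)).
  rewrite (le_trans (ler_normD _ _)) // [leRHS]addrC lerD //.
  have -> : logsum (h / z) d0.+1 - h / z = \sum_(k < d0) log_coef k.+1 * (h / z) ^+ k.+2.
    rewrite /logsum big_ord_recl addrAC {1}/log_coef expr0 divr1 mul1r expr1 subrr add0r.
    by apply: eq_bigr.
  rewrite (le_trans (ler_norm_sum _ _ _)) //.
  rewrite (@le_trans _ _ (\sum_(k < d0) `|h / z| ^+ 2 * `|h / z| ^+ k)) //.
    apply: ler_sum => k _; rewrite normrM.
    by rewrite normrX -exprD -[leRHS]mul1r ler_wpM2r ?exprn_ge0 // log_coef_le1.
  by rewrite -mulr_sumr mulrC ler_wpM2r ?exprn_ge0 // geom_le2.
have dE := diff_unique cc eL.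
split; last by move=> u; rewrite dE.
by apply/diff_locallyP; rewrite dE.
Qed.

End LogSeries.

(** * Analyticity of the logarithm of a polynomial *)
Section Composition.
Variables (K : numFieldType) (n : nat).
Implicit Types (a b h u : 'M[K]_n).
Local Notation MP := (mpoly.mpoly (n * n) K).
Local Notation coef m R := (mpoly.mcoeff m R).
Local Notation deg := mpoly.mdeg.

Lemma has_diff_log (L : K -> K) D (f : 'M[K]_n -> K) a Df :
  log_branch L D -> D (f a) -> has_diff f a Df ->
  has_diff (fun x => L (f x)) a (fun u => Df u / f a).
Proof.
move=> LB Dfa [df fE]; have [dL LE] := log_branch_diff LB Dfa.
split; first exact: (differentiable_comp df dL).
move=> u; have := diff_comp df dL => /(congr1 (@^~ u)) E.
by apply: etrans E _; rewrite /= LE fE.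
Qed.

(** Powers [R ^ k] of a polynomial without constant term have order at least
    [k], so each coefficient of a series in [R] is a finite sum. *)
Definition order_ge k (R : MP) := forall m, (deg m < k)%N -> coef m R = 0.

Lemma order_geM k l R S : order_ge k R -> order_ge l S -> order_ge (k + l) (R * S).
Proof.
move=> oR oS m dm; rewrite mpoly.mcoeffM big1 // => -[m1 m2] /= /eqP E.
have [d1|d1] := ltnP (deg m1) k; first by rewrite oR // mul0r.
have Ed := congr1 deg E; rewrite mpoly.mdegD in Ed.
rewrite oS ?mulr0 //; lia.
Qed.

Lemma order_geX k R : order_ge 1 R -> order_ge k (R ^+ k).
Proof.
move=> oR; elim: k => [|k IH] //.
by rewrite exprS -add1n; apply: order_geM.
Qed.

Definition shift_poly (P : MP) a : MP :=
  mpoly.mmap (@mpoly.mpolyC (n * n) K)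
    (fun k => mpoly.mpolyC (n * n) (mx_coord a k) + mpoly.mpolyX K (mpoly.mnm1 k)) P.

Lemma mx_coordD a h k : mx_coord (a + h) k = mx_coord a k + mx_coord h k.
Proof. by rewrite /mx_coord linearD mxE. Qed.

Lemma shift_polyE P a h : pev (shift_poly P a) h = pev P (a + h).
Proof.
rewrite /pev /shift_poly /mpoly.mmap [RHS]mpoly.mevalE raddf_sum; apply: eq_bigr => m _ /=.
rewrite mpoly.mevalM mpoly.mevalC /mpoly.mmap1 rmorph_prod; congr (_ * _).
apply: eq_bigr => k _ /=; rewrite rmorphXn /= mpoly.mevalD mpoly.mevalC mpoly.mevalXU.
by rewrite mx_coordD.
Qed.

Lemma pev0 (R : MP) : pev R 0 = coef mpoly.mnm0 R.
Proof.
have z k : `|mx_coord (0 : 'M[K]_n) k| <= 0 by rewrite /mx_coord linear0 mxE normr0.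
have z1 : mon_eval mpoly.mnm0 (mx_coord (0 : 'M[K]_n)) = 1.
  by rewrite /mon_eval big1 // => k _; rewrite mpoly.mnm0E expr0.
rewrite /pev pevE (@eq_sum_support _ _ _ [:: mpoly.mnm0]) ?big_seq1 ?z1 ?mulr1 //.
move=> m; rewrite mulf_eq0 negb_or -mpoly.mcoeff_msupp => /andP[-> mz].
rewrite inE -mpoly.mdeg_eq0; apply/esym; apply: contraNT mz => dm.
by have := mon_eval_le m z; rewrite expr0n (negPf dm) normr_le0.
Qed.

(** With [P (a + h) = z (1 + R h)], the coefficients are those of
    [L z + sum_k (-1)^k / (k + 1) R^(k+1)].  The radius is chosen such that
    [mnorm R] is at most one half on it: then the powers of [R] form a geometric
    series, and by [tail_le] with the doubled radius the truncation by degree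
    differs from the truncation by powers of [R] by [O(2^-d)]. *)
Theorem analytic_log (L : K -> K) D (P : MP) a : archimedean K -> log_branch L D ->
  D (pev P a) -> analytic_at (fun x => L (pev P x)) a.
Proof.
move=> arch LB Dz; have [z0 [e e0 He]] := LB _ Dz; set z := pev P a in Dz z0 He *.
pose R : MP := z^-1 *: shift_poly P a - 1.
have RE h : pev R h = pev P (a + h) / z - 1.
  by rewrite /pev mpoly.mevalB mpoly.mevalZ mpoly.meval1 -/(pev _ h) shift_polyE mulrC.
have R0 : coef mpoly.mnm0 R = 0 by rewrite -pev0 RE addr0 mulfV ?subrr.
have oR : order_ge 1 R.
  by move=> m; rewrite ltnS leqn0 mpoly.mdeg_eq0 => /eqP->.
pose M := mnorm 1 R; have M0 : 0 <= M by exact: mnorm_ge0.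
have n0 : 0 < `|z| by rewrite normr_gt0.
(* den bounds 1, 2 M and 2 M |z| / e, again a sum in place of a maximum; so the
   radius 1 / den keeps R below one half and z R inside the disc of L *)
pose den := 1 + 2 * M + 2 * (M * `|z|) / e.
have den1 : 1 <= den by rewrite /den -addrA lerDl addr_ge0 ?mulr_ge0 ?invr_ge0 // ltW.
have den0 : 0 < den by exact: lt_le_trans den1.
pose lam := den^-1.
have lam0 : 0 < lam by rewrite invr_gt0.
have lam1 : lam <= 1 by rewrite invf_le1.
have lamM : lam * M <= 2^-1.
  rewrite mulrC ler_pdivrMr // mulrC ler_pdivlMr // mulrC /den.
  by rewrite addrAC lerDr addr_ge0 // divr_ge0 ?mulr_ge0 // ltW.
have lamMz : lam * M * `|z| < e.
  have Mz0 : 0 <= M * `|z| by rewrite mulr_ge0.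
  have E : e * den = e + 2 * M * e + 2 * (M * `|z|) by rewrite /den; field; rewrite gt_eqF.
  rewrite -mulrA mulrC ltr_pdivrMr // E (@lt_le_trans _ _ (e + M * `|z|)) ?ltrDr //.
  by rewrite lerD // ?lerDl ?ler_peMl ?mulr_ge0 ?ler1n // ltW.
pose C : MP := mpoly.mpolyC (n * n) (L z).
pose c m := coef m C + \sum_(k < deg m) log_coef K k * coef m (R ^+ k.+1).
(* the terms with k >= deg m vanish, as R has order one *)
have cE d (m : mpoly.bmultinom (n * n) d) :
    c m = coef m C + \sum_(k < d) log_coef K k * coef m (R ^+ k.+1).
  congr (_ + _); have dm := ltnW (mpoly.bmdeg m).
  rewrite (big_ord_widen d (fun k => log_coef K k * coef m (R ^+ k.+1)) dm).
  rewrite [RHS](bigID (fun k : 'I_d => (k < deg m)%N)) /= [X in _ + X]big1 ?addr0 // => k.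
  by rewrite -leqNgt => mk; rewrite (@order_geX k.+1 _ oR) ?mulr0 // ltnS.
exists c, (lam / 2); split; first by rewrite divr_gt0.
move=> h hr.
have r0 : 0 <= lam / 2 by rewrite divr_ge0 ?ltW.
have hc k : `|mx_coord h k| <= lam / 2.
  by rewrite /mx_coord; case/mxvec_indexP: k => i j; rewrite mxvecE ltW.
have l2 : 2 * (lam / 2) = lam by rewrite mulrC divfK // pnatr_eq0.
have lam01 : 0 <= lam <= 1 by rewrite lam1 ltW.
have nR : mnorm lam R <= 2^-1 by rewrite (le_trans (mnorm_scale lam01 R0)).
have l2le : lam / 2 <= lam by rewrite ler_pdivrMr // ler_peMr ?ler1n // ltW.
have lam21 : 0 <= lam / 2 <= 1 by rewrite r0 (le_trans l2le).
have nR2 : mnorm (lam / 2) R <= lam * M.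
  by rewrite (le_trans (mnorm_scale lam21 R0)) // ler_wpM2r.
have nR2' := le_trans nR2 lamM.
pose w := pev R h.
have wR : `|w| <= mnorm (lam / 2) R by exact: meval_le.
split.
  exists (mnorm (lam / 2) C + 1) => d.
  rewrite (@le_trans _ _ (\sum_(m : mpoly.bmultinom (n * n) d)
     (`|coef m C * mon_eval m (mx_coord h)| + \sum_(k < d)
        `|coef m (R ^+ k.+1) * mon_eval m (mx_coord h)|))) //.
    apply: ler_sum => m _; rewrite cE mulrDl (le_trans (ler_normD _ _)) // lerD2l.
    rewrite mulr_suml (le_trans (ler_norm_sum _ _ _)) //; apply: ler_sum => k _.
    by rewrite -mulrA normrM ler_piMl // log_coef_le1.
  rewrite big_split exchange_big /= lerD ?truncation_abs //.
  rewrite (le_trans _ (geom_le1 d (mnorm_ge0 R r0) nR2')) //.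
  by apply: ler_sum => k _; rewrite (le_trans (truncation_abs _ _ hc r0)) // mnormX.
pose B := mnorm lam C + 1.
have B0 : 0 <= B by rewrite addr_ge0 // mnorm_ge0 // ltW.
have diffE d : `|L z + logsum w d - \sum_(m : mpoly.bmultinom (n * n) d) c m * monom m h|
    <= 2 ^- d * B.
  have -> : \sum_(m : mpoly.bmultinom (n * n) d) c m * monom m h =
     truncation d C (mx_coord h) + \sum_(k < d) log_coef K k * truncation d (R ^+ k.+1) (mx_coord h).
    under eq_bigr do rewrite cE mulrDl mulr_suml.
    rewrite big_split exchange_big /=; congr (_ + _); apply: eq_bigr => k _.
    by rewrite mulr_sumr; apply: eq_bigr => m _; rewrite mulrA.
  rewrite opprD addrACA /logsum -sumrB (le_trans (ler_normD _ _)) // mulrDr lerD //.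
    have := tail_le d C hc r0; rewrite l2; apply: le_trans.
    by rewrite mpoly.mevalC.
  rewrite mulr1 (le_trans (ler_norm_sum _ _ _)) //.
  rewrite (@le_trans _ _ (\sum_(k < d) 2 ^- d * 2^-1 ^+ k.+1)) //; last first.
    by rewrite -mulr_sumr ler_piMr ?invr_ge0 ?exprn_ge0 // geom_le1 // invr_ge0.
  apply: ler_sum => k _; rewrite -mulrBr normrM (le_trans (ler_piMl _ (log_coef_le1 _ k))) //.
  have := tail_le d (R ^+ k.+1) hc r0; rewrite l2 rmorphXn /=; move/le_trans; apply.
  rewrite ler_wpM2l ?invr_ge0 ?exprn_ge0 // (le_trans (mnormX _ _ (ltW lam0))) //.
  by rewrite lerXn2r ?nnegrE ?mnorm_ge0 ?invr_ge0 // ltW.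
have zw : `|z * w| < e.
  rewrite normrM mulrC; apply: le_lt_trans lamMz.
  by rewrite ler_wpM2r // (le_trans wR).
have zwE : z + z * w = pev P (a + h).
  by rewrite /w RE mulrBr mulr1 mulrCA mulfV // mulr1 subrKC.
have cv := He _ zw; rewrite zwE mulrAC mulfV // mul1r in cv.
apply/cvgrPdist_le => eps eps0; have e2 : 0 < eps / 2 by rewrite divr_gt0.
move/cvgrPdist_le : cv => /(_ _ e2); apply: filter_app.
apply: filterS (near_pow2 arch B0 e2) => d Hd Hd2.
rewrite (_ : L (pev P (a + h)) - _ = (L (pev P (a + h)) - L z - logsum w d) +
   (L z + logsum w d - \sum_(m : mpoly.bmultinom (n * n) d) c m * monom m h)); last by ring.
by rewrite (le_trans (ler_normD _ _)) // (splitr eps) lerD // (le_trans (diffE d)).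
Qed.

Lemma analytic_atB (f g : 'M[K]_n -> K) a :
  analytic_at f a -> analytic_at g a -> analytic_at (fun x => f x - g x) a.
Proof.
move=> [c [r [r0 Hc]]] [c' [r' [r'0 Hc']]].
have rr (x y : K) : 0 < x -> 0 < y -> (x^-1 + y^-1)^-1 <= x.
  move=> x0 y0; have : (x^-1 + y^-1)^-1 <= (x^-1)^-1.
    by rewrite lef_pV2 ?posrE ?addr_gt0 ?invr_gt0 // lerDl invr_ge0 ltW.
  by rewrite invrK.
exists (fun m => c m - c' m), (r^-1 + r'^-1)^-1.
split; first by rewrite invr_gt0 addr_gt0 // invr_gt0.
move=> h hr.
have [|[B HB] cv] := Hc h; first by move=> i j; rewrite (lt_le_trans (hr i j)) ?rr.
have [|[B' HB'] cv'] := Hc' h.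
  by move=> i j; rewrite (lt_le_trans (hr i j)) // addrC rr.
split.
  exists (B + B') => d; rewrite (le_trans _ (lerD (HB d) (HB' d))) // -big_split.
  by apply: ler_sum => m _; rewrite mulrBl ler_normB.
rewrite (_ : (fun d => _) = (fun d => \sum_(m : mpoly.bmultinom (n * n) d) c m * monom m h : K^o) -
   (fun d => \sum_(m : mpoly.bmultinom (n * n) d) c' m * monom m h : K^o)).
  exact: cvgB.
apply/funext => d; rewrite -[RHS]/(_ - _) -sumrB.
by apply: eq_bigr => m _; rewrite mulrBl.
Qed.

End Composition.

(** * The real and the complex logarithm *)
Section RealIncrement.
Variable R : realType.

Definition log_poly (c : nat -> R) d : {poly R} := \sum_(k < d) (log_coef R k * c k) *: 'X^(k.+1).

Lemma log_polyE c d t : (log_poly c d).[t] = \sum_(k < d) log_coef R k * c k * t ^+ k.+1.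
Proof. by rewrite horner_sum; apply: eq_bigr => k _; rewrite hornerZ hornerXn. Qed.

Lemma deriv_log_poly c d t : (log_poly c d)^`().[t] = \sum_(k < d) (- t) ^+ k * c k.
Proof.
rewrite raddf_sum horner_sum; apply: eq_bigr => k _ /=.
rewrite derivZ derivXn hornerZ hornerMn hornerXn /= -mulr_natr /log_coef.
rewrite [in RHS]exprNn; have : k.+1%:R != 0 :> R by rewrite pnatr_eq0.
by move: (k.+1%:R : R) => x x0; field.
Qed.

(** The mean value theorem applied to [g] minus the primitive of the
    approximation of its derivative. *)
Lemma increment_bound (g dg : R -> R) (c : nat -> R) d (e : R) :
  (forall t : R, 0 <= t <= 1 -> is_derive t 1 g (dg t)) ->
  (forall t : R, 0 <= t <= 1 -> `|dg t - \sum_(k < d) (- t) ^+ k * c k| <= e) ->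
  `|g 1 - g 0 - \sum_(k < d) log_coef R k * c k| <= e.
Proof.
move=> Hg He; pose f t := g t - (log_poly c d).[t].
have df (t : R) : 0 <= t <= 1 -> is_derive t 1 f (dg t - (log_poly c d)^`().[t]).
  by move=> t01; have H := Hg t t01; exact: is_deriveB.
have [||t t01 E] := @MVT_segment R f (fun t => dg t - (log_poly c d)^`().[t]) 0 1 ler01.
- by move=> t; rewrite in_itv /= => /andP[t0 t1]; apply: df; rewrite !ltW.
- apply: derivable_within_continuous => t; rewrite in_itv /= => t01.
  by have [] := df t t01.
have f1 : f 1 - f 0 = g 1 - g 0 - \sum_(k < d) log_coef R k * c k.
  rewrite /f !log_polyE [X in _ - (_ - X)]big1 => [|k _]; last by rewrite expr0n mulr0.
  by rewrite subr0 addrAC; congr (_ - _); apply: eq_bigr => k _; rewrite expr1n mulr1.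
rewrite -f1 E subr0 mulr1 deriv_log_poly He //; move: t01; rewrite in_itv //=.
Qed.
End RealIncrement.

Section ComplexLog.
Variable R : realType.
Local Notation C := (R[i]).
Local Notation Re := (@complex.Re R).
Local Notation Im := (@complex.Im R).
Local Open Scope complex_scope.

(** The principal logarithm on the right half plane. *)
Definition Log (z : C) : C :=
  Complex (2^-1 * ln (Re z ^+ 2 + Im z ^+ 2)) (atan (Im z / Re z)).

Lemma geometric_remainder (t : R) (w : C) d : 0 <= t <= 1 -> `|w| <= 2^-1 ->
  `|w / (1 + t%:C * w) - \sum_(k < d) (- t%:C) ^+ k * w ^+ k.+1| <= 2 ^- d.
Proof.
move=> /andP[t0 t1] w2; set x := t%:C * w.
have x2 : `|x| <= 2^-1.
  rewrite normrM (le_trans _ w2) // ler_piMl // ger0_norm ?ler0c //.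
  by rewrite -[1]/(1%:C) lecR.
have d2 : 2^-1 <= `|1 + x|.
  have half : 2^-1 + 2^-1 = 1 :> C by rewrite [RHS]splitr div1r.
  by rewrite (le_trans _ (lerB_normD _ _)) // normr1 lerBrDr -[leRHS]half lerD2l.
have d0 : 1 + x != 0 by rewrite -normr_gt0 (lt_le_trans _ d2).
have -> : w / (1 + x) - \sum_(k < d) (- t%:C) ^+ k * w ^+ k.+1 = w * (- x) ^+ d / (1 + x).
  have E : \sum_(k < d) (- t%:C) ^+ k * w ^+ k.+1 = w * \sum_(k < d) (- x) ^+ k.
    by rewrite mulr_sumr; apply: eq_bigr => k _; rewrite exprS -mulNr exprMn mulrCA.
  have G : (1 + x) * \sum_(k < d) (- x) ^+ k = 1 - (- x) ^+ d.
    by rewrite -[RHS]opprB subrX1 -[RHS]mulNr opprB opprK.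
  rewrite E -[\sum_(k < d) _](mulKf d0) G; field.
  by [].
rewrite normf_div ler_pdivrMr ?normr_gt0 // normrM normrX normrN.
rewrite (@le_trans _ _ (2^-1 * 2^-1 ^+ d)) //.
  by rewrite ler_pM ?exprn_ge0 // lerXn2r ?nnegrE ?invr_ge0.
by rewrite mulrC exprVn ler_wpM2l // invr_ge0 exprn_ge0.
Qed.

Lemma Re_sum d (r : nat -> R) (v : nat -> C) :
  Re (\sum_(k < d) (r k)%:C * v k) = \sum_(k < d) r k * Re (v k).
Proof.
rewrite (big_morph Re (id1 := 0) (op1 := +%R)) //; last by move=> [? ?] [? ?].
by apply: eq_bigr => k _; case: (v k) => a b /=; rewrite mul0r subr0.
Qed.

Lemma Im_sum d (r : nat -> R) (v : nat -> C) :
  Im (\sum_(k < d) (r k)%:C * v k) = \sum_(k < d) r k * Im (v k).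
Proof.
rewrite (big_morph Im (id1 := 0) (op1 := +%R)) //; last by move=> [? ?] [? ?].
by apply: eq_bigr => k _; case: (v k) => a b /=; rewrite mul0r addr0.
Qed.

Lemma log_coefC k : log_coef C k = (log_coef R k)%:C.
Proof. by rewrite /log_coef fmorph_div rmorphXn rmorphN1 rmorph_nat. Qed.

Lemma pow2C d : 2 ^- d = (2 ^- d)%:C :> C.
Proof. by rewrite fmorphV rmorphXn rmorph_nat. Qed.

Lemma normc_ge_Im (v : C) : `|Im v|%:C <= `|v|.
Proof.
case: v => a b; rewrite normc_def /= lecR -sqrtr_sqr ler_sqrt.
  by rewrite lerDr sqr_ge0.
by rewrite addr_ge0 // sqr_ge0.
Qed.

Lemma norm_ReIm (v : C) (e : R) : `|Re v| <= e -> `|Im v| <= e -> `|v| <= 2 * e%:C.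
Proof.
case: v => a b /= ha hb.
have -> : Complex a b = a%:C + b%:C * 'i.
  by apply/eqP; rewrite eq_complex /= !(mulr0, mulr1, mul0r, subr0, addr0, add0r) !eqxx.
rewrite (le_trans (ler_normD _ _)) // normrM.
have nC (r : R) : `|r%:C| = `|r|%:C by rewrite normc_def /= expr0n addr0 sqrtr_sqr.
have ni : `|'i%C| = 1 :> C by rewrite normc_def /= expr0n expr1n add0r sqrtr1.
by rewrite ni mulr1 !nC mulr_natl mulr2n lerD // lecR.
Qed.

(** Along the segment [z + t h] the derivative of [Log] is
    [h / (z + t h) = w / (1 + t w)], a geometric series in [w = h / z].  The real
    and imaginary parts are integrated separately. *)
Lemma Log_increment (z h : C) d : (forall t : R, 0 <= t <= 1 -> 0 < Re (z + t%:C * h)) ->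
  `|h / z| <= 2^-1 -> `|Log (z + h) - Log z - logsum (h / z) d| <= 2 * 2 ^- d.
Proof.
move=> Hpos wle; set w := h / z in wle *.
have z0 : z != 0.
  apply/eqP => z0; have := Hpos 0; rewrite lexx ler01 => /(_ isT).
  by rewrite z0 mul0r addr0 /= ltxx.
have Hgeo (t : R) : 0 <= t <= 1 ->
    `|h / (z + t%:C * h) - \sum_(k < d) (- t%:C) ^+ k * w ^+ k.+1| <= 2 ^- d.
  move=> t01; have := geometric_remainder d t01 wle.
  rewrite (_ : w / (1 + t%:C * w) = h / (z + t%:C * h)) //.
  have z1 : z + t%:C * h != 0.
    by apply: contraTneq (Hpos t t01) => ->; rewrite /= ltxx.
  by rewrite /w; field; rewrite z0 z1.
have sumE t : \sum_(k < d) (- t%:C) ^+ k * w ^+ k.+1 =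
    \sum_(k < d) ((- t) ^+ k)%:C * w ^+ k.+1.
  by apply: eq_bigr => k _; rewrite rmorphXn rmorphN.
have lsE : logsum w d = \sum_(k < d) (log_coef R k)%:C * w ^+ k.+1.
  by apply: eq_bigr => k _; rewrite log_coefC.
pose X t := Re z + t * Re h; pose Y t := Im z + t * Im h.
have XYE t : z + t%:C * h = Complex (X t) (Y t).
  rewrite /X /Y; case: (z) (h) => [a b] [p q]; apply/eqP.
  by rewrite eq_complex /= !mul0r subr0 addr0 !eqxx.
have Xpos (t : R) : 0 <= t <= 1 -> 0 < X t by move=> /Hpos; rewrite XYE.
have dX t : is_derive t (1 : R) X (Re h).
  by rewrite /X; apply: is_derive_eq; rewrite add0r mul1r scaler0 add0r /GRing.scale /= mulr1.
have dY t : is_derive t (1 : R) Y (Im h).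
  by rewrite /Y; apply: is_derive_eq; rewrite add0r mul1r scaler0 add0r /GRing.scale /= mulr1.
pose Q t := X t ^+ 2 + Y t ^+ 2.
have Qpos (t : R) : 0 <= t <= 1 -> 0 < Q t.
  by move=> t01; rewrite ltr_wpDr ?sqr_ge0 // exprn_gt0 // Xpos.
have dQ t : is_derive t (1 : R) Q (2 * (X t * Re h + Y t * Im h)).
  rewrite [Q](_ : _ = X * X + Y * Y); last by apply/funext=> s; rewrite /Q !expr2.
  have H := is_deriveD (is_deriveM (dX t) (dX t)) (is_deriveM (dY t) (dY t)).
  apply: (is_derive_eq H); rewrite /GRing.scale /=.
  by move: (X t) (Y t) (Re h) (Im h) => a b p q; ring.
have ReE (t : R) : 0 <= t <= 1 -> Re (h / (z + t%:C * h)) = (X t * Re h + Y t * Im h) / Q t.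
  move=> t01; have := Qpos t t01; rewrite XYE /Q; case: (h) => p q /= Q0.
  by field; rewrite gt_eqF.
have ImE (t : R) : 0 <= t <= 1 -> Im (h / (z + t%:C * h)) = (X t * Im h - Y t * Re h) / Q t.
  move=> t01; have := Qpos t t01; rewrite XYE /Q; case: (h) => p q /= Q0.
  by field; rewrite gt_eqF.
have dre (t : R) : 0 <= t <= 1 ->
    is_derive t (1 : R) (fun t => 2^-1 * ln (Q t)) (Re (h / (z + t%:C * h))).
  move=> t01; rewrite ReE //; have dl := is_derive1_ln (Qpos t t01).
  have dc := @is_derive1_comp R (@ln R) Q t _ _ dl (dQ t).
  have -> : (X t * Re h + Y t * Im h) / Q t = 2^-1 *: ((Q t)^-1 * (2 * (X t * Re h + Y t * Im h))).
    by rewrite /GRing.scale /= mulrCA mulKf // mulrC.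
  exact: is_deriveZ.
have dim (t : R) : 0 <= t <= 1 ->
    is_derive t (1 : R) (fun t => atan (Y t / X t)) (Im (h / (z + t%:C * h))).
  move=> t01; rewrite ImE //; have X0 := Xpos t t01.
  have X1 : X t != 0 by rewrite gt_eqF.
  have dV : is_derive t (1 : R) (fun t => Y t / X t)
     ((X t * Im h - Y t * Re h) / X t ^+ 2).
    have dI : is_derive t (1 : R) (fun t => (X t)^-1) (- (X t) ^- 2 *: Re h).
      by apply: is_deriveV.
    have H := is_deriveM (dY t) dI.
    apply: (is_derive_eq H); rewrite /GRing.scale /=.
    by move: (X t) (Y t) (Re h) (Im h) X1 => a b p q a0; field.
  have dc := @is_derive1_comp R (@atan R) (fun t => Y t / X t) t _ _ (is_derive1_atan _) dV.
  have -> : (X t * Im h - Y t * Re h) / Q t =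
    (1 + (Y t / X t) ^+ 2)^-1 * ((X t * Im h - Y t * Re h) / X t ^+ 2).
    rewrite /Q; field; rewrite (gt_eqF X0) /=.
    by rewrite gt_eqF //; exact: Qpos.
  exact: dc.
have bre := increment_bound (c := fun k => Re (w ^+ k.+1)) (d := d) (e := 2 ^- d) dre.
have bim := increment_bound (c := fun k => Im (w ^+ k.+1)) (d := d) (e := 2 ^- d) dim.
have z1E : z + h = Complex (X 1) (Y 1) by rewrite -XYE mul1r.
have z0E : z = Complex (X 0) (Y 0) by rewrite -XYE mul0r addr0.
have subE (a b : C) : Re (a - b) = Re a - Re b by case: a b => [? ?] [? ?].
have subI (a b : C) : Im (a - b) = Im a - Im b by case: a b => [? ?] [? ?].
rewrite pow2C; apply: norm_ReIm.
  rewrite subE subE lsE (Re_sum d (log_coef R) (fun k => w ^+ k.+1)) z1E {1}z0E /=; apply: bre => t t01.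
  rewrite -(@Re_sum d (fun k => (- t) ^+ k) (fun k => w ^+ k.+1)) -sumE -subE.
  by rewrite -lecR -pow2C (le_trans (normc_ge_Re _)) // Hgeo.
rewrite subI subI lsE (Im_sum d (log_coef R) (fun k => w ^+ k.+1)) z1E {1}z0E /=; apply: bim => t t01.
rewrite -(@Im_sum d (fun k => (- t) ^+ k) (fun k => w ^+ k.+1)) -sumE -subI.
by rewrite -lecR -pow2C (le_trans (normc_ge_Im _)) // Hgeo.
Qed.

Lemma archimedean_real : archimedean R.
Proof.
move=> e e0; exists (Num.bound e^-1).
have b0 : e^-1 <= 2 ^+ Num.bound e^-1.
  apply: le_trans (ltW (archi_boundP _)) _; first by rewrite invr_ge0 ltW.
  by rewrite -natrX ler_nat ltnW // ltn_expl.
by rewrite -[leRHS]invrK lef_pV2 ?posrE ?exprn_gt0 ?invr_gt0.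
Qed.

Lemma archimedean_complex : archimedean C.
Proof.
move=> e e0; have eR : e = (Re e)%:C.
  by case: e e0 => a b; rewrite ltcE /= => /andP[/eqP-> _].
have [|d Hd] := @archimedean_real (Re e).
  by move: e0; rewrite eR -[0]/(0%:C) ltcR.
by exists d; rewrite eR pow2C lecR.
Qed.

(** Dividing by [z0] turns the half plane so that it contains a given nonzero
    [z0].  The radius [|z0| Re w / 2] keeps the segment in the half plane and
    [|h / z|] below one half. *)
Lemma log_branch_Log (z0 : C) : z0 != 0 ->
  log_branch (fun z => Log (z / z0)) [set z | 0 < Re (z / z0)].
Proof.
move=> z00 z /= Rz; split; first by apply: contraTneq Rz => ->; rewrite mul0r /= ltxx.
set w := z / z0 in Rz *.
have w0 : w != 0 by apply: contraTneq Rz => ->; rewrite /= ltxx.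
exists (`|z0| * (Re w / 2)%:C).
  by rewrite mulr_gt0 ?normr_gt0 // -[0]/(0%:C) ltcR divr_gt0.
move=> h; rewrite mulrC -ltr_pdivrMr ?normr_gt0 // -normf_div; set k := h / z0 => hk.
have zn0 : z != 0 by apply: contra_neq w0 => z0'; rewrite /w z0' mul0r.
have -> : h / z = k / w by rewrite /k /w; field; rewrite ?z00 ?zn0.
rewrite mulrDl -/w -/k.
have Rk : `|Re k| < Re w / 2 by rewrite -ltcR (le_lt_trans (normc_ge_Re _)).
have kw : `|k / w| <= 2^-1.
  rewrite normf_div ler_pdivrMr ?normr_gt0 // (le_trans (ltW hk)) //.
  rewrite mulrC rmorphM fmorphV rmorph_nat ler_wpM2l ?invr_ge0 // (le_trans _ (normc_ge_Re _)) //.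
  by rewrite lecR ler_norm.
have Rpos t : 0 <= t <= 1 -> 0 < Re (w + t%:C * k).
  move=> /andP[t0 t1].
  have -> : Re (w + t%:C * k) = Re w + t * Re k.
    by case: (w) (k) => [? ?] [? ?] /=; rewrite mul0r subr0.
  rewrite -ltrBlDl sub0r; apply: (@lt_le_trans _ _ (- (Re w / 2))).
    by rewrite ltrN2 ltr_pdivrMr // ltr_pMr // ltr1n.
  rewrite lerNl (le_trans (ler_norm _)) // normrN normrM (ger0_norm t0).
  by rewrite (le_trans _ (ltW Rk)) // ler_piMl.
apply/cvgrPdist_le => e e0; apply: filterS (near_pow2 archimedean_complex (ler0n _ 2) e0) => d Hd.
by apply: le_trans (Log_increment d Rpos kw) _; rewrite mulrC.
Qed.

(** The increment is [ln (1 + h / z)], with [1 + h / z] positive, where [Log] and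
    [ln] agree; so the complex estimate applies. *)
Lemma log_branch_ln : log_branch (fun x : R => ln `|x|) [set x | x != 0].
Proof.
move=> z /= z0; split=> //; have n0 : 0 < `|z| by rewrite normr_gt0.
exists (`|z| / 2); first by rewrite divr_gt0.
move=> h; rewrite mulrC -ltr_pdivrMr // -normf_div; set k := h / z => hk.
have k1 : 0 < 1 + k.
  move: hk; rewrite ltr_norml => /andP[+ _]; rewrite -ltrBlDl sub0r; apply: lt_trans.
  by rewrite ltrN2 invf_lt1 // ltr1n.
have -> : ln `|z + h| - ln `|z| = ln (1 + k).
  have -> : z + h = z * (1 + k) by rewrite mulrDr mulr1 mulrCA mulfV // mulr1.
  by rewrite normrM (ger0_norm (ltW k1)) lnM ?posrE // addrAC subrr add0r.
apply/cvgrPdist_le => e e0; apply: filterS (near_pow2 archimedean_real (ler0n _ 2) e0) => d.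
rewrite mulrC => Hd; apply: le_trans Hd.
have nC (r : R) : `|r%:C| = `|r|%:C by rewrite normc_def /= expr0n addr0 sqrtr_sqr.
have two : (2 : C) = 2%:C by rewrite rmorph_nat.
have kC : `|k%:C / 1| <= 2^-1 :> C.
  by rewrite divr1 nC two -fmorphV lecR ltW.
have Rpos t : 0 <= t <= 1 -> 0 < Re (1 + t%:C * k%:C).
  move=> /andP[t0 t1] /=; rewrite mulr0 subr0 -ltrBlDl sub0r.
  apply: (@lt_le_trans _ _ (- 2^-1)); first by rewrite ltrN2 invf_lt1 // ltr1n.
  rewrite lerNl (le_trans (ler_norm _)) // normrN normrM (ger0_norm t0).
  by rewrite (le_trans _ (ltW hk)) // ler_piMl.
have := Log_increment d Rpos kC; rewrite divr1 pow2C.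
have -> : logsum k%:C d = (logsum k d)%:C.
  by rewrite /logsum rmorph_sum; apply: eq_bigr => i _; rewrite log_coefC -rmorphXn -rmorphM.
have -> : Log (1 + k%:C) = (ln (1 + k))%:C.
  rewrite /Log /= addr0 mul0r atan0 expr0n addr0 lnXn // -[ln _ *+ 2]mulr_natl mulKf ?pnatr_eq0 //.
have -> : Log 1 = 0 by rewrite /Log /= mul0r atan0 expr0n addr0 expr1n ln1 mulr0.
by rewrite subr0 -rmorphB nC two -rmorphM lecR.
Qed.
End ComplexLog.

(** * Assembly of the coordinates *)
Section Canonical.
Variables (K : numFieldType) (n : nat).
Implicit Types (a b u w : 'M[K]_n).

Definition pairs := [pred p : 'I_n * 'I_n | (p.1 < p.2)%N].
Definition pair_of (i : 'I_#|pairs|) : 'I_n * 'I_n := enum_val i.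

Lemma pair_of_lt i : ((pair_of i).1 < (pair_of i).2)%N.
Proof. exact: (enum_valP i). Qed.

Definition dp_pair (i : 'I_#|pairs|) := @dp K n (pair_of i).1 (pair_of i).2.
Definition dq_pair (i : 'I_#|pairs|) := @dq K n (pair_of i).1 (pair_of i).2.

(** [Omega] is the difference of two sums of [peel] terms, hence a sum over pairs
    by telescoping. *)
Lemma canonical_generic_set : canonical_on (@generic_set K n) dp_pair dq_pair.
Proof.
move=> a Ua; have reg i := generic_set_regular Ua (pair_of_lt i).
have XE i u : dp_pair i a u = _ := (dp_dqE u (reg i)).1.
have YE i u : dq_pair i a u = _ := (dp_dqE u (reg i)).2.
split=> [u w|].
  have [sa _] := (generic_setP a).1 Ua; have [gp gm] := (GLstarE a).1 sa.
  rewrite (OmegaE u w sa).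
  rewrite (factor_form_peel (@lt_ordxx n) (@lt_ord_tr n) (@lt_ord_total n)
    (@lt_ord_unit K n) u w gp).
  rewrite (factor_form_peel (@gt_ordxx n) (@gt_ord_tr n) (@gt_ord_total n)
    (@gt_ord_unit K n) u w gm).
  rewrite peel_telescope; last by move=> i j; apply: generic_set_regular Ua.
  rewrite (eq_bigl (fun p => p \in pairs)) // big_enum_val /=.
  by apply: eq_bigr => i _; rewrite /wedge !XE !YE.
have ind := forms_independent (e := pair_of) enum_val_inj pair_of_lt reg.
move=> s t H; apply: ind => u; rewrite -[RHS](H u); apply: eq_bigr => i _.
by rewrite XE YE.
Qed.

Lemma rank_generic_set a : generic_set a -> \rank (two_form_mx (Omega a)) = (n ^ 2 - n)%N.
Proof.
move=> Ua; have [OE ind] := canonical_generic_set Ua.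
have lX i (c : K) u v : dp_pair i a (c *: u + v) = c * dp_pair i a u + dp_pair i a v by exact: dp_linear.
have lY i (c : K) u v : dq_pair i a (c *: u + v) = c * dq_pair i a u + dq_pair i a v by exact: dq_linear.
have ev : odd (n ^ 2 - n) = false.
  by rewrite -mulnn; case: n => // m; rewrite [X in odd (X - _)]mulSn addKn oddM /= andbN.
by rewrite (rank_canonical lX lY OE ind) card_ord card_pairs addnn -[RHS]odd_double_half ev.
Qed.

(** The branch may depend on the polynomial: this is needed over the complex
    numbers, where the half plane is adapted to the value at a base point. *)
Variable (L : mpoly.mpoly (n * n) K -> K -> K) (D : mpoly.mpoly (n * n) K -> set K).
Hypothesis arch : archimedean K.
Hypothesis LB : forall P, P \in all_minors K n -> log_branch (L P) (D P).

Let Lf P a : K := L P (pev P a).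

Definition p_pair (i : 'I_#|pairs|) a : K :=
  let: (k, l) := pair_of i in let I := itv k.+1 l in
  Lf (schur_minor K I k l) a - Lf (adj_schurX K I k k) a - Lf (adj_schurX K I l l) a.

Definition q_pair (i : 'I_#|pairs|) a : K :=
  let: (k, l) := pair_of i in let I := itv k.+1 l in
  Lf (adj_schurX K I k l) a - Lf (adj_schurX K I l k) a.

Lemma potentials a i : (forall P, P \in all_minors K n -> D P (pev P a)) ->
  (analytic_at (p_pair i) a /\ dp_pair i a =1 'd (p_pair i : _ -> K^o) a) /\
  (analytic_at (q_pair i) a /\ dq_pair i a =1 'd (q_pair i : _ -> K^o) a).
Proof.
move=> DP; have := pair_of_lt i; rewrite /p_pair /q_pair /dp_pair /dq_pair /dp /dq.
case: (pair_of i) => k l /= kl; set I : pred 'I_n := itv k.+1 l.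
have mem P : P \in minors K k l -> P \in all_minors K n.
  by move=> Pm; apply/flatten_mapP; exists (k, l); rewrite ?mem_enum.
have an P : P \in minors K k l -> analytic_at (Lf P) a.
  by move=> /mem Pm; apply: (analytic_log arch (LB Pm)); apply: DP.
have di P : P \in minors K k l -> has_diff (Lf P) a (dlog (pev P) a).
  move=> /mem Pm; apply: has_diff_log (LB Pm) (DP P Pm) _.
  exact: has_diff_ex (differentiable_pev P a).
have m1 : schur_minor K I k l \in minors K k l by rewrite !inE eqxx ?orbT.
have m2 : adj_schurX K I k k \in minors K k l by rewrite !inE eqxx ?orbT.
have m3 : adj_schurX K I l l \in minors K k l by rewrite !inE eqxx ?orbT.
have m4 : adj_schurX K I k l \in minors K k l by rewrite !inE eqxx ?orbT.
have m5 : adj_schurX K I l k \in minors K k l by rewrite !inE eqxx ?orbT.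
split; split.
- by apply: analytic_atB; [apply: analytic_atB|]; apply: an.
- by move=> u; have [_ ->] := has_diffB (has_diffB (di _ m1) (di _ m2)) (di _ m3).
- by apply: analytic_atB; apply: an.
- by move=> u; have [_ ->] := has_diffB (di _ m4) (di _ m5).
Qed.

End Canonical.

Lemma canonical_on_eq (K : numFieldType) n (I : finType) (U : set 'M[K]_n)
    (x y x' y' : I -> 'M[K]_n -> 'M[K]_n -> K) :
  canonical_on U x y -> (forall i a, U a -> x i a =1 x' i a) ->
  (forall i a, U a -> y i a =1 y' i a) -> canonical_on U x' y'.
Proof.
move=> H xE yE a Ua; have [OE ind] := H a Ua.
have xa : x^~ a = x'^~ a by apply/funext=> i; apply/funext; apply: xE.
have ya : y^~ a = y'^~ a by apply/funext=> i; apply/funext; apply: yE.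
split=> [u w|]; last by rewrite -xa -ya.
by rewrite OE; apply: eq_bigr => i _; rewrite (funext (xE i a Ua)) (funext (yE i a Ua)).
Qed.

Lemma real_coordinates (R : realType) n : has_coordinates 'I_#|@pairs n| (@generic_set R n).
Proof.
pose L (P : mpoly.mpoly (n * n) R) (x : R) := ln `|x|.
pose D (P : mpoly.mpoly (n * n) R) := [set x : R | x != 0].
have pot a i : generic_set a -> _ :=
  fun Ua => potentials (@archimedean_real R) (L := L) (D := D)
    (fun P _ => @log_branch_ln R) i ((generic_setP a).1 Ua).2.
exists (p_pair L), (q_pair L); split=> [i a Ua|].
  by have [[ap _] [aq _]] := pot a i Ua.
refine (canonical_on_eq (@canonical_generic_set R n) _ _) => i a Ua.
  by have [[_ E] _] := pot a i Ua.
by have [_ [_ E]] := pot a i Ua.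
Qed.

Lemma Re_gt0_near1 (R : realType) (v : R[i]) : `|v - 1| < 1 -> 0 < complex.Re v.
Proof.
move=> v1; have : `|complex.Re (v - 1)| < 1.
  by rewrite -ltcR (le_lt_trans (normc_ge_Re _)).
case: v v1 => x y _ /=; rewrite ltr_norml => /andP[+ _].
by rewrite ltrBrDr addNr.
Qed.

Lemma near_ratio1 (K : numFieldType) n (P : mpoly.mpoly (n * n) K) (a : 'M[K]_n) :
  pev P a != 0 -> \forall b \near a, `|pev P b / pev P a - 1| < 1.
Proof.
move=> Pa; have n0 : 0 < `|pev P a| by rewrite normr_gt0.
have /cvgrPdist_lt /(_ _ n0) := differentiable_continuous (differentiable_pev P a).
apply: filterS => b; rewrite distrC => Hb.
by rewrite -[X in _ - X](divff Pa) -mulrBl normf_div ltr_pdivrMr // mul1r.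
Qed.

Lemma near_all_ratio1 (K : numFieldType) n (s : seq (mpoly.mpoly (n * n) K))
    (a : 'M[K]_n) : (forall P, P \in s -> pev P a != 0) ->
  \forall b \near a, forall P, P \in s -> `|pev P b / pev P a - 1| < 1.
Proof.
elim: s => [|P s IH] H.
  by apply: (@filterS _ (nbhs a) _ setT); [move=> b _ P; rewrite in_nil|exact: filterT].
have HP := near_ratio1 (H P (mem_head _ _)).
have Hs Q : Q \in s -> pev Q a != 0 by move=> Qs; apply: H; rewrite inE Qs orbT.
have := IH Hs; apply: filter_app.
apply: filterS HP => b Pb IHb Q.
by rewrite inE => /orP[/eqP->//|]; apply: IHb.
Qed.

(** A ratio at distance less than 1 from 1 has positive real part, so on this
    neighbourhood the branch adapted to the value at [a] is defined for each of
    the polynomials. *)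
Lemma open_ratio1 (K : numFieldType) n (s : seq (mpoly.mpoly (n * n) K)) (a : 'M[K]_n) :
  (forall P, P \in s -> pev P a != 0) ->
  exists V : set 'M[K]_n, [/\ open V, V a &
    forall b, V b -> forall P, P \in s -> `|pev P b / pev P a - 1| < 1].
Proof.
move=> H; pose W := [set b | forall P, P \in s -> `|pev P b / pev P a - 1| < 1].
exists W^°; split; [exact: open_interior| |by move=> b /interior_subset].
exact: near_all_ratio1.
Qed.

Lemma complex_coordinates (R : realType) n :
  has_multivalued_coordinates 'I_#|@pairs n| (@generic_set R[i] n).
Proof.
exists (@dp_pair R[i] n), (@dq_pair R[i] n); split; last exact: canonical_generic_set.
move=> a Ua; have Pa := ((generic_setP a).1 Ua).2.
pose L (P : mpoly.mpoly (n * n) R[i]) (z : R[i]) := Log (z / pev P a).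
pose D (P : mpoly.mpoly (n * n) R[i]) := [set z : R[i] | 0 < complex.Re (z / pev P a)].
have LB P : P \in all_minors R[i] n -> log_branch (L P) (D P).
  by move=> /Pa; apply: log_branch_Log.
have [V [oV Va VD]] := open_ratio1 Pa; exists V; split=> //.
have DV b : V b -> forall P, P \in all_minors R[i] n -> D P (pev P b).
  by move=> Vb P Pm; apply: Re_gt0_near1; apply: VD.
exists (p_pair L), (q_pair L) => i; split=> b /DV Db.
  exact: (potentials (@archimedean_complex R) LB i Db).1.
exact: (potentials (@archimedean_complex R) LB i Db).2.
Qed.

Theorem theorem4p1 (R : realType) (n : nat) :
  ((exists U : set 'M[R]_n,
      [/\ dense_open_algebraic U,
          has_coordinates 'I_((n ^ 2 - n)./2) U
        & forall a, U a -> \rank (two_form_mx (Omega a)) = (n ^ 2 - n)%N])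
   /\ closed_on GLstar (@Omega R n))
  /\
  ((exists U : set 'M[R[i]]_n,
      [/\ dense_open_algebraic U,
          has_multivalued_coordinates 'I_((n ^ 2 - n)./2) U
        & forall a, U a -> \rank (two_form_mx (Omega a)) = (n ^ 2 - n)%N])
   /\ closed_on GLstar (@Omega R[i] n)).
Proof.
split; split; try exact: closed_Omega.
  exists (@generic_set R n); split; [exact: dense_open_generic_set| |exact: rank_generic_set].
  by rewrite -(card_pairs n); exact: real_coordinates.
exists (@generic_set R[i] n); split; [exact: dense_open_generic_set| |exact: rank_generic_set].
by rewrite -(card_pairs n); exact: complex_coordinates.
Qed.
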